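(* Let $T>0$, let $(W_t)_{0\le t\le T}$ be a standard Brownian motion and let $(X_t)_{0\le t\le T}$ be a finite variation real L\'evy process with characteristics $(\lambda,0,\nu)$, independent of $W$. Set $$\eta^T_t=W_t-\frac tT W_T+\frac tT X_t,\qquad 0\le t\le T.$$ Then the process $(\tilde M^T_t,\ 0\le t\le T)$ given by $$\tilde M^T_t=\eta^T_t-\int_0^t\frac{\left(\lambda-\int_{|x|<1}x\,\nu(\mathrm dx)\right)s+T\sum_{0<u\le s}\frac{\Delta\eta^T_u}{u}-\eta^T_s}{T-s}\,\mathrm ds-\frac{t^2}{2T}\left(\lambda+\int_{|x|\ge1}x\,\nu(\mathrm dx)\right)$$ is a martingale with respect to the natural filtration $\mathbb F^{\eta^T}$ of $\eta^T$.
   Context: The L\'evy process $X$ (c\`adl\`ag, $X_0=0$) with characteristics $(\lambda,0,\nu)$ and finite variation has the L\'evy--It\^o form $$X_t=\left(\lambda-\int_{|x|<1}x\,\nu(\mathrm dx)\right)t+\sum_{s\le t}\Delta X_s,\qquad 0\le t\le T,$$ where $\nu$ is the L\'evy measure and $\lambda\in\mathbb R$ is the drift coefficient relative to the truncation function $x\mathbf 1_{\{|x|<1\}}$. For a c\`adl\`ag process $Z$, $\Delta Z_u=Z_u-Z_{u-}$. The natural filtration $\mathbb F^{\eta^T}$ is the filtration generated by $\eta^T$.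
   Formalization: The formal statement adds the assumption that x is ν-integrable over |x|≥1 (X has finite mean); without it the integral over |x|≥1 in the last term is infinite or undefined, e.g. ν(dx)=x^{-2}dx on x≥1, and the process is not a martingale. *)

(* Defs.v *)
From HB Require Import structures.
From mathcomp Require Import all_boot all_order all_algebra.
From mathcomp Require Import all_classical all_reals all_analysis.
Set Implicit Arguments.
Unset Strict Implicit.
Unset Printing Implicit Defensive.
Import Order.TTheory GRing.Theory Num.Theory.
Import numFieldNormedType.Exports.
Local Open Scope classical_set_scope.
Local Open Scope ring_scope.

(** A process on [0, T] is a family [Y : R -> Omega -> R], of which only the
    times in [0, T] are ever constrained or used. *)

Section sigma_fields.
Context d (Omega : measurableType d) (R : realType).
Implicit Types (Y : R -> Omega -> R) (F G : set (set Omega)).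

Definition sigma_process (I : set R) Y : set (set Omega) :=
  <<s \bigcup_(u in I) preimage_set_system setT (Y u) measurable >>.

(** Not augmented by the null sets. *)
Definition natural_filtration Y (t : R) : set (set Omega) :=
  sigma_process `[0, t] Y.

Definition sub_measurable F (Z : Omega -> R) : Prop :=
  preimage_set_system setT Z measurable `<=` F.

Variable P : probability Omega R.

Definition indep_sigma F G : Prop :=
  forall A B, F A -> G B -> P (A `&` B) = (P A * P B)%E.

(** [Z] is a version of the conditional expectation of [V] given [G]. *)
Definition is_cond_exp G (V Z : Omega -> R) : Prop :=
  [/\ sub_measurable G Z,
      P.-integrable setT (EFin \o Z) &
      forall A, G A -> (\int[P]_(w in A) (Z w)%:E = \int[P]_(w in A) (V w)%:E)%E].

Definition martingale (F : R -> set (set Omega)) (T : R) (M : R -> Omega -> R)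
    : Prop :=
  [/\ forall t, 0 <= t <= T -> sub_measurable (F t) (M t),
      forall t, 0 <= t <= T -> P.-integrable setT (EFin \o M t) &
      forall s t, 0 <= s -> s <= t -> t <= T -> is_cond_exp (F s) (M t) (M s)].

End sigma_fields.

Section paths.
Context (R : realType).
Implicit Types (f : R -> R) (u t T : R) (D : set R).

(** Sum of a real family over an arbitrary index set, meaningful when the family
    is absolutely summable (in particular at most countably many nonzero terms). *)
Definition rsum D f : R :=
  fine (\esum_(u in D) (f^\+ u)%:E - \esum_(u in D) (f^\- u)%:E)%E.

Definition jump f u : R := f u - lim (f v @[v --> u^'-]).

Definition cadlag T f : Prop :=
  (forall t, 0 <= t < T -> f v @[v --> t^'+] --> f t) /\
  (forall t, 0 < t <= T -> cvg (f v @[v --> t^'-])).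

Definition jump_count f t (A : set R) : \bar R :=
  counting [set u | [/\ 0 < u, u <= t, jump f u != 0 & A (jump f u)]].

End paths.

Section brownian_levy.
Context d (Omega : measurableType d) (R : realType) (P : probability Omega R).

(** The second argument of [normal_prob] is the standard deviation. *)
Record brownian_motion (T : R) (W : R -> {RV P >-> R}) : Prop := {
  bm_start : forall w, W 0 w = 0 ;
  bm_continuous : forall w, {within `[0, T], continuous (fun t => W t w)} ;
  bm_indep : forall s t, 0 <= s -> s <= t -> t <= T ->
    indep_sigma P (natural_filtration (fun u => W u : Omega -> R) s)
                  (g_sigma_algebra_preimage (W t \- W s)) ;
  bm_gauss : forall s t, 0 <= s -> s < t -> t <= T ->
    forall B : set R, measurable B ->
      pushforward P (W t \- W s) B = normal_prob 0 (Num.sqrt (t - s)) B }.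

Record levy_process (T : R) (X : R -> {RV P >-> R}) : Prop := {
  levy_start : forall w, X 0 w = 0 ;
  levy_cadlag : forall w, cadlag T (fun t => X t w) ;
  levy_indep : forall s t, 0 <= s -> s <= t -> t <= T ->
    indep_sigma P (natural_filtration (fun u => X u : Omega -> R) s)
                  (g_sigma_algebra_preimage (X t \- X s)) ;
  levy_stationary : forall s t, 0 <= s -> s <= t -> t <= T ->
    forall B : set R, measurable B ->
      pushforward P (X t \- X s) B = pushforward P (X (t - s)) B }.

Definition is_levy_measure (nu : {measure set (measurableTypeR R) -> \bar R})
    : Prop :=
  nu [set 0] = 0%E /\ (\int[nu]_x (Num.min (x ^+ 2) 1)%:E < +oo)%E.

(** lambda - int_{|x| < 1} x nu(dx) *)
Definition fv_drift (lambda : R)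
    (nu : {measure set (measurableTypeR R) -> \bar R}) : R :=
  lambda - \int[nu]_(x in [set x | `|x| < 1]) x.

(** Finite variation Levy process with characteristics (lambda, 0, nu) for the
    truncation x 1_{|x| < 1}.  As for semimartingale characteristics,
    dt nu(dx) is the intensity (compensator) of the jump measure of X, and
    lambda is the drift that remains once the jumps are compensated; for
    a finite variation process without Gaussian part this is the Levy-Ito form
    [fvl_levy_ito], whose drift involves int_{|x| < 1} x nu(dx), finite by
    [fvl_small_jumps]. *)
Record fv_levy_process (T : R) (X : R -> {RV P >-> R}) (lambda : R)
    (nu : {measure set (measurableTypeR R) -> \bar R}) : Prop := {
  fvl_levy : levy_process T X ;
  fvl_variation : {ae P, forall w, bounded_variation 0 T (fun t => X t w)} ;
  fvl_levy_measure : is_levy_measure nu ;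
  fvl_small_jumps : nu.-integrable [set x | `|x| < 1] (fun x => x%:E) ;
  fvl_jump_intensity : forall t (A : set R), 0 <= t <= T -> measurable A ->
    (\int[P]_w jump_count (fun u => X u w) t A = t%:E * nu A)%E ;
  fvl_levy_ito : {ae P, forall w, forall t, 0 <= t <= T ->
    X t w = fv_drift lambda nu * t
            + rsum [set s | 0 < s <= t] (jump (fun u => X u w))} }.

Definition indep_processes (T : R) (W X : R -> {RV P >-> R}) : Prop :=
  indep_sigma P (sigma_process `[0, T] (fun u => W u : Omega -> R))
                (sigma_process `[0, T] (fun u => X u : Omega -> R)).

Definition eta_bridge (T : R) (W X : R -> {RV P >-> R}) (t : R) (w : Omega) : R :=
  W t w - t / T * W T w + t / T * X t w.

Definition Mtilde (T lambda : R)
    (nu : {measure set (measurableTypeR R) -> \bar R})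
    (e : R -> Omega -> R) (t : R) (w : Omega) : R :=
  let ew := fun u => e u w in
  e t w
  - \int[lebesgue_measure]_(s in `[0, t])
      ((fv_drift lambda nu * s
        + T * rsum [set u | 0 < u <= s] (fun u => jump ew u / u)
        - e s w) / (T - s))
  - t ^+ 2 / (2 * T)
    * (lambda + \int[nu]_(x in [set x | 1 <= `|x|]) x).

End brownian_levy.

(* Main.v *)
(** Up to time s the process eta only depends on W and X up to s and on
    W_T - W_s.  Given these, the bridge b_r = W_r - (r/T) W_T has mean
    (T - r)/(T - s) b_s for s <= r <= T: the pair (W_r - W_s, W_T - W_r) is
    independent of the past of W, and its Gaussian density is invariant under the
    reflection that preserves the sum of the pair and changes the sign of
    (T - r)(W_r - W_s) - (r - s)(W_T - W_r).  Likewise X_r has conditional mean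
    X_s + m (r - s) with m = lambda + int_{|x| >= 1} x nu(dx); here E X_t = m t
    comes from the Levy-Ito form and the intensity of the jumps, by approximating
    their sizes with step functions.

    The jump of eta at u is u/T times that of X, so the Levy-Ito form turns the
    numerator of the drift into X_r - eta_r, and
    (X_r - eta_r)/(T - r) = X_r/T - b_r/(T - r) has an affine conditional mean in
    r on [s, T[.  Fubini's theorem, justified by the bound
    E |X_r - eta_r|/(T - r) <= K + sqrt 2/sqrt (T - r), then gives the martingale
    property by integrating this affine function. *)

Require Import Defs.
From HB Require Import structures.
From mathcomp Require Import all_boot all_order all_algebra.
From mathcomp Require Import all_classical all_reals all_analysis.
From mathcomp Require Import measurable_realfun.
From mathcomp Require Import ring lra.
Import Order.TTheory GRing.Theory Num.Theory.
Import numFieldNormedType.Exports.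
Set Implicit Arguments.
Unset Strict Implicit.
Unset Printing Implicit Defensive.
Local Open Scope classical_set_scope.
Local Open Scope ring_scope.

(** * Right-continuous paths and sums over their jumps *)

Section rcll.
Context {R : realType}.
Implicit Types (f : R -> R) (a b x s e : R).

(** The natural filtration is not augmented, so adaptedness cannot be read off from the almost sure
    identity between the numerator of the drift and X_r - eta_r: the sum of the Delta eta_u / u over
    uncountably many times has to be a measurable function of the path itself. Hence the machinery
    of jump sums. For a test function vanishing below a positive level only finitely many jumps
    count, and increments over finer and finer grids recover them; positive parts are increasing
    limits of such test functions. The same machinery gives joint measurability in outcome and time,
    and turns the intensity of the jumps into E X_t.

    No conditional expectation or conditional density is ever constructed. Conditional means appear
    as equalities between integrals over the events of a pi-system, extended by a Dynkin class
    argument to a sigma-field larger than the natural filtration. *)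

Definition rcll f := (forall x, f v @[v --> x^'+] --> f x) /\
  (forall x, cvg (f v @[v --> x^'-])).

Lemma at_right_dist f x l e : f v @[v --> x^'+] --> l -> 0 < e ->
  exists2 r, 0 < r & forall v, x < v < x + r -> `|f v - l| < e.
Proof.
move=> /cvgrPdist_lt fl e0; have := fl _ e0.
rewrite near_withinE => /nbhs_ballP[r /= r0 rP]; exists r => // v /andP[xv vr].
rewrite distrC; apply: rP => //; rewrite /ball/= ltr_distlC.
by apply/andP; split; lra.
Qed.

Lemma at_left_dist f x l e : f v @[v --> x^'-] --> l -> 0 < e ->
  exists2 r, 0 < r & forall v, x - r < v < x -> `|f v - l| < e.
Proof.
move=> /cvgrPdist_lt fl e0; have := fl _ e0.
rewrite near_withinE => /nbhs_ballP[r /= r0 rP]; exists r => // v /andP[xv vr].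
rewrite distrC; apply: rP => //; rewrite /ball/= ltr_distlC.
by apply/andP; split; lra.
Qed.

Lemma rcll_right f x e : rcll f -> 0 < e ->
  exists2 r, 0 < r & forall v, x <= v < x + r -> `|f v - f x| < e.
Proof.
move=> [/(_ x) fr _] e0; have [r r0 rP] := at_right_dist fr e0.
exists r => // v /andP[]; rewrite le_eqVlt => /predU1P[<-|xv vr].
  by rewrite subrr normr0.
by apply: rP; rewrite xv.
Qed.

(** Two points on the same side of [x] are both close to [f x] or both close to the left limit. By
    right continuity [x] belongs to its right side, hence the half-open condition [u < x <= v]. *)
Lemma rcll_osc f x e : rcll f -> 0 < e -> exists2 r, 0 < r &
  forall u v, x - r < u -> u < v -> v < x + r -> ~ (u < x <= v) ->
    `|f v - f u| < e.
Proof.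
move=> rf e0; have e20 : 0 < e / 2 by lra.
have [r r0 rP] := rcll_right x rf e20.
have [q q0 qP] := at_left_dist (rf.2 x) e20.
have [m m0 [mr mq]] : exists2 m, 0 < m & m <= r /\ m <= q.
  by exists (Num.min r q); rewrite ?lt_min ?r0// !ge_min !lexx orbT.
exists m => // u v xu uv vx uxv.
have tri (l : R) : `|f u - l| < e / 2 -> `|f v - l| < e / 2 -> `|f v - f u| < e.
  move=> ul vl; rewrite [e]splitr (le_lt_trans (ler_distD l _ _))//.
  by rewrite ltrD// distrC.
have [xu'|ux] := leP x u.
  by apply: (tri (f x)); apply: rP; lra.
have [vx'|xv] := ltP v x; last by exfalso; apply: uxv; rewrite ux.
by apply: (tri (lim (f v @[v --> x^'-]))); apply: qP; lra.
Qed.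

Lemma seq_gt0_lb (T : eqType) (C : seq T) (r : T -> R) :
  (forall c, c \in C -> 0 < r c) ->
  exists2 e, 0 < e & forall c, c \in C -> e <= r c.
Proof.
elim: C => [_|c C ih rC]; first by exists 1.
have [|e e0 eC] := ih; first by move=> x xC; apply: rC; rewrite inE xC orbT.
exists (Num.min (r c) e); first by rewrite lt_min e0 rC ?mem_head.
move=> x; rewrite inE ge_min => /predU1P[->|/eC ->]; first by rewrite lexx.
by rewrite orbT.
Qed.

(* The exceptional points [C] are the centers of a finite subcover. *)
Lemma rcll_finite_osc f a b e : rcll f -> 0 < e ->
  exists (C : seq R) r, 0 < r /\ forall u v, a <= u -> u < v -> v <= b ->
    v - u < r -> (forall c, c \in C -> ~ (u < c <= v)) -> `|f v - f u| < e.
Proof.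
move=> rf e0.
have /choice[r rP] : forall x, exists r : R, 0 < r /\ forall u v : R,
    x - r < u -> u < v -> v < x + r -> ~ (u < x <= v) -> `|f v - f u| < e.
  by move=> x; have [r r0 rP] := rcll_osc x rf e0; exists r.
have r0 x : 0 < r x by have [] := rP x.
have : compact `[a, b] by exact: segment_compact.
rewrite compact_cover => /(_ R setT (fun x => ball x (r x / 2))).
case=> [x _|x _|C _ CP]; first exact: ball_open.
  by exists x => //; apply: ballxx; rewrite divr_gt0.
have [m m0 mP] := @seq_gt0_lb _ (finmap.enum_fset C) (fun x => r x / 2) (fun c _ => divr_gt0 (r0 c) (ltr0Sn _ 1)).
exists (finmap.enum_fset C), m; split=> // u v au uv vb vum Cuv.
have [|c /= cC cu] := CP u; first by rewrite /= in_itv/= au (le_trans (ltW uv)).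
have mc := mP _ cC; have [_ cP] := rP c.
move: cu; rewrite /ball/= ltr_distlC => /andP[? ?].
by apply: cP => //; [lra|lra|exact: Cuv].
Qed.

End rcll.

(** * Jump sums as limits along grids *)

Section grid_sums.
Context {R : realType}.
Variables (a : R) (psi h : R -> R).
Hypotheses (a0 : 0 < a) (psi_ge0 : forall x, 0 <= psi x)
  (psi_small : forall x, x <= a -> psi x = 0) (cpsi : continuous psi)
  (h_ge0 : forall x : R, 0 < x -> 0 <= h x)
  (ch : forall x : R, 0 < x -> {for x, continuous h}).
Implicit Types (f : R -> R) (s c : R) (n : nat).

(** The weight sits at the right end of each cell: for [s > 0] this point is positive, so [h] may be
    the inverse, and it tends to the jump time contained in the cell as the mesh shrinks. *)
Definition grid_sum f s n : R :=
  \sum_(i < n.+1) psi (f (s * (i.+1%:R / n.+1%:R)) - f (s * (i%:R / n.+1%:R)))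
                  * h (s * (i.+1%:R / n.+1%:R)).

Lemma grid_index s c n : 0 < c <= s -> exists i : 'I_n.+1,
  s * (i%:R / n.+1%:R) < c <= s * (i.+1%:R / n.+1%:R).
Proof.
move=> /andP[c0 cs]; pose P (k : nat) := c <= s * (k.+1%:R / n.+1%:R).
have Pn : P n by rewrite /P divff ?mulr1.
have exP : exists k, P k by exists n.
case: (ex_minnP exP) => k Pk kmin.
have kn : (k < n.+1)%N by rewrite ltnS kmin.
exists (Ordinal kn) => /=; rewrite [X in _ && X]Pk andbT.
case: k Pk kmin {kn} => [|k] _ kmin; first by rewrite mul0r mulr0.
by rewrite ltNge; apply/negP => /kmin; rewrite ltnn.
Qed.

(** A jump above [a] at [u] would show in [f u - f (u - m)] for small [m], while []u - m, u]] avoids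
    [C] and the oscillation hypothesis keeps this increment below [a]. *)
Lemma small_osc_jump f (C : seq R) r u s : rcll f -> 0 < r -> 0 < u <= s ->
  (forall x y, 0 <= x -> x < y -> y <= s -> y - x < r ->
     (forall c, c \in C -> ~ (x < c <= y)) -> `|f y - f x| < a) ->
  u \notin C -> psi (jump f u) = 0.
Proof.
move=> rf r0 /andP[u0 us] fC uC; apply: psi_small; rewrite leNgt; apply/negP => ja.
have e0 : 0 < jump f u - a by lra.
have [q q0 qP] := at_left_dist (rf.2 u) e0.
have [|p p0 pC] := @seq_gt0_lb _ _ [seq c <- C | c < u] (fun c => u - c).
  by move=> c; rewrite mem_filter => /andP[cu _]; lra.
(* The four bounds keep [u - m] close enough for the left limit ([q]), within the mesh ([r]), above
   all points of [C] before [u] ([p]), and positive. Half of the minimum makes them strict. *)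
have [m m0 [mq [mr [mp mu]]]] :
    exists2 m, 0 < m & m < q /\ m < r /\ m < p /\ m < u.
  exists (Num.min q (Num.min r (Num.min p u)) / 2).
    by rewrite divr_gt0// !lt_min q0 r0 p0 u0.
  set M := Num.min q _.
  have M0 : 0 < M by rewrite !lt_min q0 r0 p0 u0.
  have: M <= q /\ M <= r /\ M <= p /\ M <= u.
    by rewrite !ge_min !lexx ?orbT.
  by move=> [? [? [? ?]]]; do !split; lra.
have /ltr_normlP[fq1 fq2] : `|f (u - m) - lim (f v @[v --> u^'-])| < jump f u - a.
  by apply: qP; lra.
suff /ltr_normlP[? ?] : `|f u - f (u - m)| < a by rewrite /jump in ja fq1 fq2; lra.
apply: fC => //; [lra|lra|lra|move=> c cC /andP[? cu]].
have {}cu : c < u by rewrite lt_neqAle cu andbT; apply: contraNneq uC => <-.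
by have := pC c; rewrite mem_filter cu cC => /(_ isT); lra.
Qed.

Lemma psi0 : psi 0 = 0. Proof. by apply: psi_small; exact: ltW. Qed.

Lemma esum_jumps_finite f (C : seq R) s : uniq C ->
  (forall u, 0 < u <= s -> u \notin C -> psi (jump f u) = 0) ->
  (forall c, c \in C -> 0 < c <= s) ->
  (\esum_(u in [set u | 0 < u <= s]%R) (psi (jump f u) * h u)%:E)%E =
  (\sum_(c <- C) psi (jump f c) * h c)%:E.
Proof.
move=> uC fC C0.
transitivity (\esum_(u in [set u | 0 < u <= s]%R `&` [set` C])
    (psi (jump f u) * h u)%:E)%E.
  rewrite esum_mkcondr; apply: eq_esum => u us; case: ifPn => //.
  by rewrite notin_setE/= => /negP uC'; rewrite fC// mul0r.
rewrite (_ : _ `&` _ = [set` C]); last first.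
  by apply/seteqP; split=> [u []//|u /= uC']; split=> //; exact: C0.
rewrite esum_fset; [|exact: finite_seq|].
  by rewrite -fsbig_seq// sumEFin.
move=> c; rewrite inE/= => /C0/andP[c0 _]; rewrite lee_fin mulr_ge0//.
exact: h_ge0.
Qed.

(** The right ends of the cells containing [c] stay at or above [c], the left ends strictly below:
    right continuity and the left limit apply, so the increment over the cell tends to
    [jump f c]. *)
Lemma grid_right_cvg f s c (k : nat -> nat) : rcll f ->
  (forall n, s * ((k n)%:R / n.+1%:R) < c <= s * ((k n).+1%:R / n.+1%:R)) ->
  s * ((k n).+1%:R / n.+1%:R) @[n --> \oo] --> c /\
  f (s * ((k n).+1%:R / n.+1%:R)) @[n --> \oo] --> f c /\
  f (s * ((k n)%:R / n.+1%:R)) @[n --> \oo] --> lim (f v @[v --> c^'-]).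
Proof.
move=> rf kc.
have step n : s * ((k n).+1%:R / n.+1%:R) = s * ((k n)%:R / n.+1%:R) + s / n.+1%:R.
  by rewrite -(natr1 (k n)) mulrDl mulrDr mul1r.
have cs : s / n.+1%:R @[n --> \oo] --> (0 : R).
  by rewrite -[X in _ --> X](mulr0 s); apply: cvgM; [exact: cvg_cst|exact: cvg_harmonic].
have small r : 0 < r -> \forall n \near \oo, c - r < s * ((k n)%:R / n.+1%:R) < c /\
    c <= s * ((k n).+1%:R / n.+1%:R) < c + r.
  move=> r0; move/cvgrPdist_lt : cs => /(_ _ r0); apply: filterS => n.
  rewrite sub0r normrN => /ltr_normlP[H1 H2].
  have := kc n; rewrite !step; move: (s * _) (s / _) H1 H2 => x y ? ? /andP[? ?].
  by split; apply/andP; split; lra.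
split; [|split]; apply/cvgrPdist_lt => e e0.
- by apply: filterS (small _ e0) => n [_ /andP[H1 H2]]; rewrite ltr_distlC; rewrite H2 (lt_le_trans _ H1)// ltrBlDr ltrDl.
- have [r r0 rP] := rcll_right c rf e0.
  by apply: filterS (small _ r0) => n [_ ?]; rewrite distrC; exact: rP.
- have [r r0 rP] := at_left_dist (rf.2 c) e0.
  by apply: filterS (small _ r0) => n [? _]; rewrite distrC; exact: rP.
Qed.

(** Once the mesh is small, each cell holds at most one exceptional point, and a cell without any
    has an increment below [a], killed by [psi]. What remains is a finite sum indexed by the
    exceptional points, each term of which converges. *)
Lemma grid_sum_cvg f s : rcll f -> 0 < s ->
  (grid_sum f s n)%:E @[n --> \oo] -->
  (\esum_(u in [set u | 0 < u <= s]%R) (psi (jump f u) * h u)%:E)%E.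
Proof.
move=> rf s0; have [C0 [r [r0 C0P]]] := rcll_finite_osc 0 s rf a0.
pose C := undup [seq c <- C0 | 0 < c <= s].
have uC : uniq C by exact: undup_uniq.
have memC (c : R) : (c \in C) = (0 < c <= s) && (c \in C0).
  by rewrite mem_undup mem_filter.
rewrite (@esum_jumps_finite f C)//; last 2 first.
- move=> u us uC'; apply: (@small_osc_jump f C0 r u s rf r0 us C0P).
  by move: uC'; rewrite memC us.
- by move=> c; rewrite memC => /andP[].
have C0P' c : c \in C -> 0 < c <= s by rewrite memC => /andP[].
apply: cvg_EFin; first by exact: nearW.
(* [k (n, c)] is the index of the cell of mesh [s / n.+1] that contains [c]. *)
have /choice[k kP] : forall nc : nat * R, exists k : nat, 0 < nc.2 <= s ->
    (k < nc.1.+1)%N /\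
    s * (k%:R / nc.1.+1%:R) < nc.2 <= s * (k.+1%:R / nc.1.+1%:R).
  move=> [n c]; have [cs|] := boolP (0 < c <= s); last by exists 0%N.
  by have [i iP] := grid_index n cs; exists i => _; split.

have kcvg c (cC : c \in C) :=
  @grid_right_cvg f s c (fun n => k (n, c)) rf (fun n => (kP (n, c) (C0P' c cC)).2).
pose g c n := psi (f (s * ((k (n, c)).+1%:R / n.+1%:R)) - f (s * ((k (n, c))%:R / n.+1%:R)))
                  * h (s * ((k (n, c)).+1%:R / n.+1%:R)).
have gcvg : \sum_(c <- C | c \in C) g c n @[n --> \oo] -->
    \sum_(c <- C | c \in C) psi (jump f c) * h c.
  apply: cvg_big => [|c cC]; first exact: add_continuous.
  have [Rc [fR fL]] := kcvg c cC.
  apply: cvgM.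
    have H : f (s * ((k (n, c)).+1%:R / n.+1%:R)) - f (s * ((k (n, c))%:R / n.+1%:R))
      @[n --> \oo] --> jump f c by exact: cvgB.
    exact: (continuous_cvg _ (@cpsi (jump f c)) H).
  have c0 : 0 < c by have /andP[] := C0P' _ cC.
  exact: (continuous_cvg _ (@ch _ c0) Rc).
rewrite big_seq; apply: cvg_trans gcvg; apply: near_eq_cvg.
(* A lower bound for the gaps between exceptional points: a mesh below it forbids two of them in one
   cell, which makes [K] below injective. *)
have [m m0 mP] : exists2 m, 0 < m & forall x y, x \in C -> y \in C -> x < y -> m <= y - x.
  have [|m m0 mP] := @seq_gt0_lb R _ [seq xy <- [seq (x, y) | x <- C, y <- C] | xy.1 < xy.2]
      (fun xy => xy.2 - xy.1).
    by move=> c; rewrite mem_filter => /andP[c12 _]; rewrite subr_gt0.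
  exists m => // x y xC yC xy; apply: (mP (x, y)).
  by rewrite mem_filter xy/=; apply/allpairsP; exists (x, y).
have mesh : \forall n \near \oo, s / n.+1%:R < Num.min r m.
  have cs : s / n.+1%:R @[n --> \oo] --> (0 : R).
    rewrite -[X in _ --> X](mulr0 s); apply: cvgM; [exact: cvg_cst|].
    exact: cvg_harmonic.
  have rm0 : 0 < Num.min r m by rewrite lt_min r0.
  move/cvgrPdist_lt : cs => /(_ _ rm0); apply: filterS => n.
  by rewrite sub0r normrN; exact: le_lt_trans (ler_norm _).
apply: filterS mesh => n; rewrite lt_min => /andP[nr nm].
have step (i : nat) : s * (i.+1%:R / n.+1%:R) = s * (i%:R / n.+1%:R) + s / n.+1%:R.
  by rewrite -(natr1 i) mulrDl mulrDr mul1r.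
pose F (i : 'I_n.+1) := psi (f (s * (i.+1%:R / n.+1%:R)) - f (s * (i%:R / n.+1%:R)))
                  * h (s * (i.+1%:R / n.+1%:R)).
pose K c : 'I_n.+1 := inord (k (n, c)).
have KE c : c \in C -> K c = k (n, c) :> nat.
  by move=> /C0P' /(kP (n, c))[? _]; rewrite inordK.
have Kinj : {in C &, injective K}.
  move=> x y xC yC Kxy; apply/eqP/negPn/negP => xy.
  wlog {xy} xy : x y xC yC Kxy / x < y.
    by move=> H; move: xy; rewrite neq_lt => /orP[]; [|move/esym in Kxy]; apply: H.
  have kxy : k (n, x) = k (n, y) by rewrite -!KE// Kxy.
  have [_ /= /andP[x1 x2]] := kP (n, x) (C0P' _ xC).
  have [_ /= /andP[y1 y2]] := kP (n, y) (C0P' _ yC).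
  have := mP _ _ xC yC xy; move: x1 x2 y1 y2; rewrite kxy step.
  by move: (s * _) (s / _) nm => p q; lra.
rewrite [RHS]/= /grid_sum; transitivity (\sum_(c <- C) F (K c)).
  by rewrite big_seq; apply: eq_bigr => c cC; rewrite /g /F KE.
rewrite -(big_map K xpredT F)/= big_uniq ?map_inj_in_uniq//=.
(* It remains to see that a cell whose index is not of the form [K c] contributes nothing. *)
rewrite big_mkcond/=; apply: eq_bigr => i _; case: ifPn => // iC.
rewrite /F psi_small ?mul0r// ltW//; apply: le_lt_trans (ler_norm _) _.
have i0 : 0 <= s * (i%:R / n.+1%:R) by rewrite mulr_ge0 ?divr_ge0// ltW.
have isn : s * (i.+1%:R / n.+1%:R) <= s.
  rewrite -[leRHS]mulr1 ler_pM2l// ler_pdivrMr// mul1r ler_nat.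
  exact: ltn_ord.
apply: C0P => //.
- by rewrite step ltrDl divr_gt0.
- by rewrite step addrAC subrr add0r.
- move=> c cC0 /andP[ci ic].
  have c0s : 0 < c <= s.
    rewrite (le_lt_trans i0 ci) (le_trans ic)//.
  have cC : c \in C by rewrite memC c0s.
  case/mapP: iC; exists c => //; apply/val_inj => /=; rewrite KE//.
  have [_ /= /andP[x1 x2]] := kP (n, c) c0s.
  have lt_nat (p q : nat) : s * (p%:R / n.+1%:R) < s * (q%:R / n.+1%:R) -> (p < q)%N.
    by rewrite ltr_pM2l// ltr_pM2r// ltr_nat.
  apply/eqP; rewrite eqn_leq; apply/andP; split; rewrite -ltnS; apply: lt_nat.
    exact: lt_le_trans ci x2.
  exact: lt_le_trans x1 ic.
Qed.

End grid_sums.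

(** A finite subsum of the limit is the limit of finite subsums, each below the supremum over [n] of
    the full sums; this is the nontrivial inequality. *)
Lemma esum_nondecreasing_cvg (R : realType) (T : choiceType) (D : set T)
    (g : nat -> T -> \bar R) (g' : T -> \bar R) :
  (forall n u, D u -> (0 <= g n u)%E) ->
  (forall u, D u -> {homo g^~ u : m n / (m <= n)%N >-> (m <= n)%E}) ->
  (forall u, D u -> g n u @[n --> \oo] --> g' u) ->
  (\esum_(u in D) g n u)%E @[n --> \oo] --> (\esum_(u in D) g' u)%E.
Proof.
move=> g0 gh gg'.
have gg'_le n u : D u -> (g n u <= g' u)%E.
  move=> Du; rewrite (cvg_unique _ (gg' u Du) (ereal_nondecreasing_cvgn (gh u Du))) //.
  exact: ereal_sup_ubound.
have homo_sum : {homo (fun n => \esum_(u in D) g n u)%E : m n / (m <= n)%N >-> (m <= n)%E}.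
  by move=> m n mn; apply: le_esum => u Du; exact: gh.
suff -> : (\esum_(u in D) g' u)%E = ereal_sup (range (fun n => \esum_(u in D) g n u)%E).
  exact: ereal_nondecreasing_cvgn.
apply/eqP; rewrite eq_le; apply/andP; split; last first.
  by apply: ge_ereal_sup => _ [n _ <-]; apply: le_esum => u Du; exact: gg'_le.
apply: ge_ereal_sup => _ [A [finA AD] <-].
rewrite fsbig_finite//= big_seq.
have memA u : u \in finmap.enum_fset (fset_set A) -> D u.
  by rewrite in_fset_set// inE; exact: AD.
have cv : (\sum_(u <- finmap.enum_fset (fset_set A) | u \in finmap.enum_fset (fset_set A)) g n u)%E
    @[n --> \oo] --> (\sum_(u <- finmap.enum_fset (fset_set A) | u \in finmap.enum_fset (fset_set A)) g' u)%E.
  apply: cvg_nnesum => u /memA Du; last exact: gg'.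
  by apply: nearW => n; exact: g0.
rewrite -(cvg_lim _ cv)//; apply: lime_le; first by apply/cvg_ex; eexists; exact: cv.
apply: nearW => n /=.
apply: (@le_trans _ _ (\esum_(u in D) g n u)%E); last first.
  by apply: ereal_sup_ubound; exists n.
apply: esum_ge; exists A; first by split.
by rewrite fsbig_finite//= -big_seq.
Qed.

(** Kept in the extended reals so that it makes sense without summability. The weight [h] is the
    inverse in the drift and the constant 1 in the Levy-Ito sum. *)
Definition jump_sum {R : realType} (phi h f : R -> R) (t : R) : \bar R :=
  (\esum_(u in [set u | 0 < u <= t]%R) (phi (jump f u) * h u)%:E)%E.

(** * Joint measurability of jump sums in outcome and time *)

Section joint_measurability.
Context d (S : measurableType d) (R : realType).
Implicit Types (Y : R -> S -> R).

Lemma measurable_rcont Y : (forall u, measurable_fun setT (Y u)) ->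
  (forall w x, Y v w @[v --> x^'+] --> Y x w) ->
  measurable_fun setT (fun p : S * R => Y p.2 p.1).
Proof.
move=> mY cY.
(* A grid point strictly to the right of [x], at distance at most [1 / n.+1]: countably many values
   for each [n], and a right limit as [n] grows. *)
pose q n (x : R) : R := (Num.floor (x * n.+1%:R) + 1)%:~R / n.+1%:R.
apply: (@measurable_fun_cvg _ _ _ setT (fun n (p : S * R) => Y (q n p.2) p.1)).
  move=> n _ B mB; rewrite setTI.
  have -> : (fun p : S * R => Y (q n p.2) p.1) @^-1` B =
      \bigcup_(k : int) ((Y ((k + 1)%:~R / n.+1%:R) @^-1` B) `*`
         `[k%:~R / n.+1%:R, (k + 1)%:~R / n.+1%:R[).
    apply/seteqP; split => [[w x]/= Bwx|[w x] /= [k _ [/= Bk]]].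
      exists (Num.floor (x * n.+1%:R)) => //; split => //=.
      by rewrite in_itv/= ler_pdivrMr// ltr_pdivlMr// floor_itv.
    rewrite in_itv/= ler_pdivrMr// ltr_pdivlMr// => /floor_def fk.
    by rewrite /q fk.
  apply: countable_bigcupT_measurable => // k; apply: measurableX => //.
  by rewrite -[X in measurable X]setTI; exact: mY.
move=> [w x] _ /=; apply/cvgrPdist_lt => e e0.
have [r r0 rP] := at_right_dist (cY w x) e0.
have /cvgrPdist_lt/(_ _ r0) := @cvg_harmonic R.
apply: filterS => n; rewrite sub0r normrN gtr0_norm ?harmonic_gt0// => nr.
rewrite distrC; apply: rP; have /andP[f1 f2] := floor_itv (x * n.+1%:R).
rewrite /q ltr_pdivlMr// f2/= intrD mulrDl.
apply: ler_ltD; first by rewrite ler_pdivrMr.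
by rewrite mul1r.
Qed.

(** The test functions to which [grid_sum_cvg] applies. They drop negative jumps, which are
    recovered by applying the results to the opposite path. *)
Definition cutoff (psi : R -> R) := [/\ continuous psi, forall x, 0 <= psi x &
  exists2 a : R, 0 < a & forall x, x <= a -> psi x = 0].

Section weighted_jumps.
Variables (Y : R -> S -> R) (h : R -> R).
Hypotheses (mY : forall u, measurable_fun setT (Y u))
  (cY : forall w, rcll (Y^~ w)).
Hypotheses (mh : measurable_fun setT h) (h0 : forall x : R, 0 < x -> 0 <= h x)
  (ch : forall x : R, 0 < x -> {for x, continuous h}).

Lemma measurable_esum_cutoff (psi : R -> R) : cutoff psi ->
  measurable_fun setT (fun p : S * R =>
    jump_sum psi h (Y^~ p.1) p.2).
Proof.
move=> [cpsi psi0 [a a0 psia]].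
have mYp : measurable_fun setT (fun p : S * R => Y p.2 p.1).
  by apply: measurable_rcont => // w; exact: (cY w).1.
(* For a time at most 0 the index set is empty; replacing the time by 0 makes all grid increments
   zero, so that the grid sums vanish too. *)
pose s (p : S * R) := Num.max p.2 0.
have ms : measurable_fun setT s.
  by apply: measurable_maxr; [exact: measurable_snd|exact: measurable_cst].
have mYs (q : R) : measurable_fun setT (fun p : S * R => Y (s p * q) p.1).
  apply: (measurableT_comp mYp (g := fun p => (p.1, s p * q))).
  apply: measurable_fun_pair; first exact: measurable_fst.
  exact: measurable_funM.
apply: (emeasurable_fun_cvg (fun n p => (grid_sum psi h (Y^~ p.1) (s p) n)%:E)).
  move=> n; apply/measurable_EFinP; apply: measurable_sum => i.
  apply: measurable_funM.
    apply: measurableT_comp; first exact: continuous_measurable_fun.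
    exact: measurable_funB.
  apply: measurableT_comp => //; exact: measurable_funM.
move=> [w t] _; rewrite /s/= /jump_sum; have [t0|t0] := leP t 0.
  rewrite (_ : [set u | 0 < u <= t]%R = set0); last first.
    by apply/seteqP; split=> u //= /andP[u0 ut]; have := lt_le_trans u0 (le_trans ut t0); rewrite ltxx.
  rewrite esum_set0; apply: cvg_near_cst; apply: nearW => n.
  rewrite /grid_sum big1// => i _; rewrite !mul0r subrr psia ?mul0r//.
  exact: ltW.
exact: (grid_sum_cvg a0).
Qed.

Lemma measurable_esum_jumps (psi : nat -> R -> R) (phi : R -> R) :
  (forall n, cutoff (psi n)) ->
  (forall x, {homo psi^~ x : m n / (m <= n)%N >-> m <= n}) ->
  (forall x, psi n x @[n --> \oo] --> phi x) ->
  measurable_fun setT (fun p : S * R =>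
    jump_sum phi h (Y^~ p.1) p.2).
Proof.
move=> cpsi hpsi psiphi.
apply: (emeasurable_fun_cvg (fun n (p : S * R) =>  jump_sum (psi n) h (Y^~ p.1) p.2)).
  by move=> n; exact: measurable_esum_cutoff.
move=> [w t] _ /=; apply: esum_nondecreasing_cvg => [n u /= /andP[u0 _]|u /= /andP[u0 _] m n mn|u /= /andP[u0 _]].
- by have [_ p0 _] := cpsi n; rewrite lee_fin mulr_ge0 ?h0.
- by rewrite lee_fin ler_wpM2r ?h0// hpsi.
- apply: cvg_EFin; first exact: nearW.
  by apply: cvgM; [exact: psiphi|exact: cvg_cst].
Qed.

End weighted_jumps.
End joint_measurability.

Section cutoffs.
Context {R : realType}.
Implicit Types (f h : R -> R) (x c : R).

Definition ppart x : R := Num.max x 0.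

Lemma ppart_ge0 x : 0 <= ppart x. Proof. by rewrite le_max lexx orbT. Qed.

Lemma continuous_ppart : continuous ppart.
Proof.
by move=> x; apply: continuous_max; [exact: cvg_id|exact: cvg_cst].
Qed.

(** The shift makes the positive part vanish near 0, hence a [cutoff], and it decreases to 0 so that
    the approximation is increasing. *)
Definition ppart_approx (n : nat) x := ppart (x - n.+1%:R^-1).

Lemma cutoff_ppart n : cutoff (ppart_approx n).
Proof.
split => [x|x|]; last 1 first.
- exists n.+1%:R^-1; first by rewrite invr_gt0.
  by move=> x xn; rewrite /ppart_approx/ppart max_r// subr_le0.
- apply: (@continuous_comp _ _ _ (fun x => x - n.+1%:R^-1) ppart); last exact: continuous_ppart.
  by apply: cvgB; [exact: cvg_id|exact: cvg_cst].
- exact: ppart_ge0.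
Qed.

Lemma ppart_approx_homo x : {homo ppart_approx^~ x : m n / (m <= n)%N >-> m <= n}.
Proof.
move=> m n mn; rewrite /ppart_approx/ppart ge_max !le_max lexx orbT andbT.
by rewrite lerB// lef_pV2 ?posrE// ler_nat.
Qed.

Lemma ppart_approx_cvg x : ppart_approx n x @[n --> \oo] --> ppart x.
Proof.
rewrite -[X in ppart X](subr0 x).
have H : (x - n.+1%:R^-1) @[n --> \oo] --> x - 0.
  by apply: cvgB; [exact: cvg_cst|exact: cvg_harmonic].
exact: (continuous_cvg _ (@continuous_ppart (x - 0)) H).
Qed.

Definition above c x : R := if c < x then 1 else 0.

(** A ramp capped at 1. It increases to the indicator of the open half-line, which is why [above]
    uses a strict inequality. *)
Definition above_approx c (n : nat) x : R := Num.min (n%:R * ppart (x - c)) 1.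

Lemma cutoff_above c n : 0 < c -> cutoff (above_approx c n).
Proof.
move=> c0; split => [x|x|]; last 1 first.
- exists c => // x xc; rewrite /above_approx/ppart max_r ?subr_le0// mulr0.
  by rewrite min_l.
- apply: (@continuous_min _ _ (fun y => n%:R * ppart (y - c)) (fun=> 1) x); last exact: cvg_cst.
  apply: cvgM; first exact: cvg_cst.
  apply: (@continuous_comp _ _ _ (fun x => x - c) ppart); last exact: continuous_ppart.
  by apply: cvgB; [exact: cvg_id|exact: cvg_cst].
- by rewrite le_min ler01 andbT mulr_ge0// ppart_ge0.
Qed.

Lemma above_approx_homo c x : {homo (fun n => above_approx c n x) : m n / (m <= n)%N >-> m <= n}.
Proof.
move=> m n mn; rewrite /above_approx le_min !ge_min lexx orbT andbT.
by rewrite ler_wpM2r ?ppart_ge0 ?ler_nat.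
Qed.

Lemma above_approx_cvg c x : above_approx c n x @[n --> \oo] --> above c x.
Proof.
rewrite /above /above_approx/ppart; have [cx|xc] := ltP c x; last first.
  apply: cvg_near_cst; apply: nearW => n.
  by rewrite max_r ?subr_le0// mulr0 min_l.
have xc0 : 0 < x - c by lra.
apply: cvg_near_cst; exists (Num.trunc (x - c)^-1).+1 => // n /= ntrunc.
rewrite max_l ?ltW// min_r// -ler_pdivrMr// div1r ltW//.
by apply: lt_le_trans (truncnS_gt _) _; rewrite ler_nat.
Qed.

Lemma jumpN f x : rcll f -> jump (\- f) x = - jump f x.
Proof.
move=> [_ /(_ x) fx]; rewrite /jump opprB [LHS]/= addrC; congr (_ + _).
by rewrite limN// opprK.
Qed.

Lemma rcllN f : rcll f -> rcll (\- f).
Proof.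
move=> [fr fl]; split => x; first by apply: cvgN; exact: fr.
by apply: is_cvgN; exact: fl.
Qed.

(** The negative jumps of [f] are the positive jumps of its opposite, and a nonnegative weight goes
    through positive parts; both halves are then jump sums of [ppart]. *)
Lemma rsum_jump h f t : rcll f -> (forall x, 0 < x -> 0 <= h x) ->
  rsum [set u | 0 < u <= t] (fun u => jump f u * h u) =
  fine (jump_sum ppart h f t - jump_sum ppart h (\- f)%R t)%E.
Proof.
move=> rf h0; rewrite /rsum; congr (fine (_ - _)); apply: eq_esum => u /= /andP[u0 _].
  by rewrite /funrpos/ppart [in RHS]maxr_pMl ?h0// mul0r.
by rewrite /funrneg/ppart jumpN// [in RHS]maxr_pMl ?h0// mul0r mulNr.
Qed.

End cutoffs.

Section measurable_rsum.
Context d (S : measurableType d) (R : realType).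
Variables (Y : R -> S -> R) (h : R -> R).
Hypotheses (mY : forall u, measurable_fun setT (Y u))
  (cY : forall w, rcll (Y^~ w)).
Hypotheses (mh : measurable_fun setT h) (h0 : forall x : R, 0 < x -> 0 <= h x)
  (ch : forall x : R, 0 < x -> {for x, continuous h}).

Lemma measurable_jump_sum_ppart :
  measurable_fun setT (fun p : S * R => jump_sum ppart h (Y^~ p.1) p.2).
Proof.
apply: (@measurable_esum_jumps _ _ _ _ _ mY cY mh h0 ch ppart_approx).
- exact: cutoff_ppart.
- exact: ppart_approx_homo.
- exact: ppart_approx_cvg.
Qed.

Lemma measurable_jump_sum_above (c : R) : 0 < c ->
  measurable_fun setT (fun p : S * R => jump_sum (above c) h (Y^~ p.1) p.2).
Proof.
move=> c0; apply: (@measurable_esum_jumps _ _ _ _ _ mY cY mh h0 ch (above_approx c)).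
- by move=> n; exact: cutoff_above.
- exact: above_approx_homo.
- exact: above_approx_cvg.
Qed.

End measurable_rsum.

Lemma measurable_rsum_jump d (S : measurableType d) (R : realType)
    (Y : R -> S -> R) (h : R -> R) :
  (forall u, measurable_fun setT (Y u)) -> (forall w, rcll (Y^~ w)) ->
  measurable_fun setT h -> (forall x : R, 0 < x -> 0 <= h x) ->
  (forall x : R, 0 < x -> {for x, continuous h}) ->
  measurable_fun setT (fun p : S * R =>
    rsum [set u | 0 < u <= p.2] (fun u => jump (Y^~ p.1) u * h u)).
Proof.
move=> mY cY mh h0 ch.
rewrite (_ : (fun p : S * R => _) = (fun p => fine (jump_sum ppart h (Y^~ p.1) p.2
   - jump_sum ppart h (\- Y^~ p.1)%R p.2)%E)); last first.
  by apply/funext => p; rewrite rsum_jump.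
apply: measurableT_comp => //; apply: emeasurable_funB.
  exact: measurable_jump_sum_ppart.
apply: (@measurable_jump_sum_ppart _ _ _ (fun u w => - Y u w)) => //.
  by move=> u; exact: measurable_funN.
by move=> w; exact: rcllN.
Qed.

(** * Freezing paths outside a time interval *)

Section clamp.
Context {R : realType}.
Implicit Types (f g : R -> R) (x t u v T l : R).

(** Precomposing with [clamp t] freezes a path before 0 and after [t]. A path that is only cadlag on
    [0, T] becomes [rcll] on the whole line, with unchanged jumps on ]0, t], and nothing after [t]
    is read, which is what adaptedness asks. *)
Definition clamp t v : R := Num.max 0 (Num.min v t).

Lemma clamp_id t v : 0 <= v <= t -> clamp t v = v.
Proof. by move=> /andP[v0 vt]; rewrite /clamp min_l// max_r. Qed.

Lemma clamp_ge t v : 0 <= t <= v -> clamp t v = t.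
Proof. by move=> /andP[t0 tv]; rewrite /clamp min_r// max_r. Qed.

Lemma clamp_le0 t v : 0 <= t -> v <= 0 -> clamp t v = 0.
Proof. by move=> t0 v0; rewrite /clamp max_l// ge_min v0. Qed.

Lemma clamp_itv t v : 0 <= t -> 0 <= clamp t v <= t.
Proof. by move=> t0; rewrite /clamp le_max lexx/= ge_max t0 ge_min lexx orbT. Qed.

(** An equality of propositions rather than an implication, so that the set of left limits, and
    hence the [lim] chosen from it in [jump], can be rewritten even where no limit is known to
    exist. *)
Lemma at_left_eq_cvg f g x l a : a < x -> (forall v, a < v < x -> f v = g v) ->
  (f v @[v --> x^'-] --> l) = (g v @[v --> x^'-] --> l).
Proof.
move=> ax fg.
have near_eq : \forall v \near x^'-, f v = g v.
  near=> v; apply: fg; apply/andP; split; last by near: v; exact: nbhs_left_lt.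
  by near: v; exact: nbhs_left_gt.
rewrite propeqE; split; apply: cvg_trans; apply: near_eq_cvg => //.
by apply: filterS near_eq.
Unshelve. all: end_near. Qed.

Lemma at_right_eq_cvg f g x l b : x < b -> (forall v, x < v < b -> f v = g v) ->
  f v @[v --> x^'+] --> l -> g v @[v --> x^'+] --> l.
Proof.
move=> xb fg; apply: cvg_trans; apply: near_eq_cvg; near=> v.
apply: fg; apply/andP; split; first by near: v; exact: nbhs_right_gt.
by near: v; exact: nbhs_right_lt.
Unshelve. all: end_near. Qed.

Lemma rcll_clamp T t f : cadlag T f -> 0 <= t <= T -> rcll (f \o clamp t).
Proof.
move=> [fr fl] /andP[t0 tT]; split => x.
  have [x0|x0] := ltP x 0.
    apply: (@at_right_eq_cvg (cst (f 0)) _ _ _ 0) => //.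
      by move=> v /andP[_ v0]; rewrite /= clamp_le0// ltW.
    by rewrite /= clamp_le0// ?ltW//; exact: cvg_cst.
  have [tx|xt] := leP t x.
    apply: (@at_right_eq_cvg (cst (f t)) _ _ _ (x + 1)); first by rewrite ltrDl.
      by move=> v /andP[xv _]; rewrite /= clamp_ge// t0 (le_trans tx)// ltW.
    by rewrite /= clamp_ge// ?t0//; exact: cvg_cst.
  apply: (@at_right_eq_cvg f _ _ _ t) => //.
    by move=> v /andP[xv vt]; rewrite /= clamp_id// (le_trans x0) ltW.
  rewrite /= clamp_id ?x0 ?ltW//; apply: fr.
  by rewrite x0 (lt_le_trans xt).
have [x0|x0] := leP x 0.
  apply/cvg_ex; exists (f 0); rewrite (@at_left_eq_cvg _ (cst (f 0)) _ _ (x - 1)).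
  - exact: cvg_cst.
  - by rewrite ltrBlDr ltrDl.
  - by move=> v /andP[_ vx]; rewrite /= clamp_le0// (le_trans (ltW vx)).
have [tx|xt] := ltP t x.
  apply/cvg_ex; exists (f t); rewrite (@at_left_eq_cvg _ (cst (f t)) _ _ t)//.
    exact: cvg_cst.
  by move=> v /andP[tv vx]; rewrite /= clamp_ge// t0 ltW.
have /cvg_ex[l fxl] : cvg (f v @[v --> x^'-]).
  by apply: fl; rewrite x0 (le_trans xt).
apply/cvg_ex; exists l; rewrite (@at_left_eq_cvg _ f _ _ 0)//.
by move=> v /andP[v0 vx]; rewrite /= clamp_id// ltW//= (le_trans (ltW vx)).
Qed.

Lemma jump_eq f g a x : a < x -> (forall v, a < v <= x -> f v = g v) ->
  jump f x = jump g x.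
Proof.
move=> ax fg; rewrite /jump fg ?ax ?lexx//; congr (_ - _).
rewrite /lim/lim_in; congr (get _); apply/funext => l.
by rewrite (@at_left_eq_cvg f g x l a)// => v /andP[av vx]; rewrite fg// av ltW.
Qed.

Lemma jump_clamp f t u : 0 < u <= t -> jump (f \o clamp t) u = jump f u.
Proof.
move=> /andP[u0 ut]; apply: (@jump_eq _ _ 0) => // v /andP[v0 vu].
by rewrite /= clamp_id// ltW//= (le_trans vu).
Qed.

Lemma left_cont_jumpD f g c x : f v @[v --> x^'-] --> f x ->
  cvg (g v @[v --> x^'-]) -> jump (fun v => f v + c * v * g v) x = c * x * jump g x.
Proof.
move=> fx gx; rewrite /jump.
have /cvg_lim -> // : f v + c * v * g v @[v --> x^'-] --> f x + c * x * lim (g v @[v --> x^'-]).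
  apply: cvgD => //; apply: cvgM => //; apply: cvgM; first exact: cvg_cst.
  exact: cvg_within.
ring.
Qed.

End clamp.

(** * Mean of a finite variation Levy process *)

Lemma cvg_ge0_integral d (S : measurableType d) (R : realType)
    (mu : {measure set S -> \bar R}) (g : nat -> S -> \bar R) (g' : S -> \bar R) :
  (forall n, measurable_fun setT (g n)) -> (forall n x, (0 <= g n x)%E) ->
  (forall x, {homo g^~ x : m n / (m <= n)%N >-> (m <= n)%E}) ->
  (forall x, g n x @[n --> \oo] --> g' x) ->
  (\int[mu]_x g n x)%E @[n --> \oo] --> (\int[mu]_x g' x)%E.
Proof.
move=> mg g0 hg gg'.
rewrite (_ : (\int[mu]_x g' x)%E = (\int[mu]_x (fun x => limn (g^~ x)) x)%E).
  by apply: cvg_monotone_convergence => // x _; exact: hg.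
by apply: eq_integral => x _; apply/esym/cvg_lim => //; exact: gg'.
Qed.

Section esum_counting.
Context {R : realType} {T : choiceType}.
Implicit Types (D : set T).

Lemma le_esumZl D (c : R) (a : T -> \bar R) : 0 <= c ->
  (forall u, D u -> (0 <= a u)%E) ->
  (\esum_(u in D) (c%:E * a u) <= c%:E * \esum_(u in D) a u)%E.
Proof.
move=> c0 a0; apply: ge_ereal_sup => _ [A [finA AD] <-].
rewrite fsbig_finite//= big_seq -ge0_sume_distrr => [|u]; last first.
  by rewrite in_fset_set// inE => /AD/a0.
rewrite lee_wpmul2l//; apply: esum_ge; exists A => //.
by rewrite fsbig_finite//= -big_seq.
Qed.

(** The missing inequality is [le_esumZl] again, with the factor [c^-1]. *)
Lemma esumZl D (c : R) (a : T -> \bar R) : 0 <= c ->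
  (forall u, D u -> (0 <= a u)%E) ->
  (\esum_(u in D) (c%:E * a u) = c%:E * \esum_(u in D) a u)%E.
Proof.
move=> c0 a0; apply/eqP; rewrite eq_le le_esumZl//=.
have [->|cn0] := eqVneq c 0.
  by rewrite mul0e esum_ge0// => u Du; rewrite mul0e.
have {cn0}c0 : 0 < c by rewrite lt_neqAle eq_sym cn0.
have H : (\esum_(u in D) a u <= c^-1%:E * \esum_(u in D) (c%:E * a u))%E.
  apply: (@le_trans _ _ (\esum_(u in D) (c^-1%:E * (c%:E * a u)))%E).
    by apply: le_esum => u Du; rewrite muleA -EFinM mulVf ?gt_eqF// mul1e.
  apply: le_esumZl; first by rewrite invr_ge0 ltW.
  by move=> u Du; rewrite mule_ge0 ?a0// lee_fin ltW.
have c0e : (0 <= c%:E)%E by rewrite lee_fin ltW.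
apply: (le_trans (lee_wpmul2l c0e H)).
by rewrite muleA -EFinM divff ?gt_eqF// mul1e.
Qed.

(** Links the jump counts of the intensity hypothesis to jump sums. For an infinite set, finite
    subsets of every size make the sum exceed any bound. *)
Lemma esum1_counting D : (\esum_(u in D) 1)%E = counting D :> \bar R.
Proof.
rewrite /counting; case: asboolP => [finD|infD].
  rewrite esum_fset// fsbig_finite//= big_const_seq count_predT.
  by elim: size => //= n ->; rewrite -EFinD -natr1 addrC.
apply/eqyP => A A0; have [B BD AB] := infinite_set_fset (Num.trunc A).+1 infD.
apply: (@le_trans _ _ (size (finmap.enum_fset B))%:R%:E).
  by rewrite lee_fin (le_trans (ltW (truncnS_gt A)))// ler_nat.
apply: esum_ge; exists [set` finmap.enum_fset B].
  by split; [exact: finite_seq|exact: BD].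
rewrite -fsbig_seq ?finmap.fset_uniq// big_const_seq count_predT.
rewrite le_eqVlt; apply/orP; left; apply/eqP.
by elim: size => //= n <-; rewrite -EFinD -natr1 addrC.
Qed.

End esum_counting.

(** * Jump counts and staircase approximations *)

Section jump_sums.
Context {R : realType}.
Implicit Types (f : R -> R) (c t : R).

(** With [c > 0] the clause [jump f u != 0] of [jump_count] is automatic. *)
Lemma jump_count_above f c t : 0 < c ->
  jump_count f t [set x | c < x] = jump_sum (above c) (cst 1) f t.
Proof.
move=> c0; rewrite /jump_count -esum1_counting /jump_sum.
transitivity (\esum_(u in [set u | 0 < u <= t]%R `&` [set u | c < jump f u]%R) 1%:E : \bar R)%E.
  congr esum; apply/seteqP; split => u /=.
    by move=> [u0 ut _ cu]; rewrite u0 ut.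
  by move=> [/andP[u0 ut] cu]; split => //; rewrite gt_eqF// (lt_trans c0).
rewrite esum_mkcondr; apply: eq_esum => u _.
rewrite mulr1 /above (_ : (u \in _) = (c < jump f u)); last by apply/idP/idP; rewrite inE.
by case: ifP.
Qed.

Lemma jump_count_below f c t : rcll f -> 0 < c ->
  jump_count f t [set x | x < - c] = jump_sum (above c) (cst 1) (\- f) t.
Proof.
move=> rf c0; rewrite -jump_count_above// /jump_count; congr counting.
by apply/seteqP; split => u /=; rewrite jumpN// oppr_eq0 ltrNr.
Qed.

Lemma aboveE c : above c = \1_[set x | c < x].
Proof.
apply/funext => x; rewrite indicE /above.
rewrite (_ : (x \in _) = (c < x)); last by apply/idP/idP; rewrite inE.
by case: ifP.
Qed.

Lemma set_above c : [set x | c < x] = `]c, +oo[%classic.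
Proof. by apply/seteqP; split=> x /=; rewrite in_itv/= andbT. Qed.

(* Lower approximation of the positive part by a multiple of [e] capped at
   [K * e], written with the half-line indicators [above]. *)
Definition staircase (e : R) (K : nat) (x : R) : R :=
  \sum_(k < K) e * above (k.+1%:R * e) x.

Lemma staircase_ge0 e K x : 0 <= e -> 0 <= staircase e K x.
Proof.
by move=> e0; apply: sumr_ge0 => k _; rewrite mulr_ge0// /above; case: ifP.
Qed.

Lemma staircase_le e K x : 0 <= e -> staircase e K x <= ppart x.
Proof.
(* The cap [K%:R * e] is added to the bound so that the induction can absorb one more step of height
   [e]. *)
move=> e0; suff : staircase e K x <= Num.min (ppart x) (K%:R * e) by rewrite le_min => /andP[].
elim: K => [|K]; first by rewrite /staircase big_ord0 mul0r le_min ppart_ge0/=.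
rewrite /staircase big_ord_recr/= -/(staircase e K x) !le_min => /andP[h1 h2].
have Ke : K.+1%:R * e = K%:R * e + e by rewrite -natr1 mulrDl mul1r.
rewrite /above; case: ifPn => [Kx|_]; last first.
  by rewrite mulr0 addr0 h1 Ke (le_trans h2)// lerDl.
rewrite mulr1 Ke lerD// andbT /ppart le_max; apply/orP; left.
by rewrite (le_trans _ (ltW Kx))// Ke lerD.
Qed.

(** Rounding loses at most one step, since the level [k.+1%:R * e] counts only once strictly
    exceeded. With all [K] levels passed the value is [K%:R * e], the cap [K.+1%:R * e] minus
    [e]. *)
Lemma staircase_ge e K x : 0 <= e -> Num.min x (K.+1%:R * e) - e <= staircase e K x.
Proof.
move=> e0; elim: K => [|K].
  by rewrite /staircase big_ord0 mul1r subr_le0 ge_min lexx orbT.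
rewrite /staircase big_ord_recr/= -/(staircase e K x) => ih.
have Ke : K.+2%:R * e = K.+1%:R * e + e by rewrite -natr1 mulrDl mul1r.
rewrite {1}/above; case: ifPn => [Kx|].
  rewrite mulr1 lerBlDr ge_min; apply/orP; right; rewrite Ke lerD2r.
  by move: ih; rewrite (min_r (ltW Kx)) lerBlDr.
rewrite -leNgt => xK; rewrite mulr0 addr0; move: ih; rewrite (min_l xK); apply: le_trans.
by rewrite lerD2r ge_min lexx.
Qed.

Lemma jump_sum_staircase e K f t : 0 <= e ->
  jump_sum (staircase e K) (cst 1) f t =
  (\sum_(k < K) e%:E * jump_sum (above (k.+1%:R * e)%R) (cst 1%R) f t)%E.
Proof.
move=> e0; rewrite /jump_sum.
have above0 c u : (0 <= (above c (jump f u) * 1)%:E)%E.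
  by rewrite lee_fin mulr1 /above; case: ifP.
transitivity (\sum_(k < K) \esum_(u in [set u | 0 < u <= t]%R)
    (e%:E * (above (k.+1%:R * e)%R (jump f u) * 1)%:E))%E.
  rewrite -esum_sum; last by move=> u k _ _; rewrite mule_ge0.
  by apply: eq_esum => u _; rewrite /staircase mulr1 -sumEFin; apply: eq_bigr => k _; rewrite -EFinM/= mulr1.
by apply: eq_bigr => k _; rewrite esumZl.
Qed.

(** The truncation at [n.+1] allows domination by a finite staircase; the shift pays for the
    rounding loss and makes the function a [cutoff]. *)
Definition ppart_trunc (n : nat) (x : R) : R :=
  ppart (Num.min x n.+1%:R - n.+1%:R^-1).

Lemma ppart_trunc_homo x : {homo ppart_trunc^~ x : m n / (m <= n)%N >-> m <= n}.
Proof.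
move=> m n mn; rewrite /ppart_trunc/ppart ge_max !le_max lexx orbT andbT.
rewrite lerB ?lef_pV2 ?posrE ?ler_nat//.
by rewrite le_min !ge_min lexx/= ler_nat ltnS mn orbT.
Qed.

Lemma ppart_trunc_cvg x : ppart_trunc n x @[n --> \oo] --> ppart x.
Proof.
apply: cvg_trans (@ppart_approx_cvg _ x); apply: near_eq_cvg.
exists (Num.trunc x).+1 => // n /= xn; rewrite /ppart_approx/ppart_trunc min_l//.
by rewrite ltW// (lt_le_trans (truncnS_gt _))// ler_nat ltnW.
Qed.

Lemma continuous_ppart_trunc n : continuous (ppart_trunc n).
Proof.
move=> x; apply: (@continuous_comp R R R (fun x : R => Num.min x n.+1%:R - n.+1%:R^-1 : R) ppart).
  apply: cvgB; last exact: cvg_cst.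
  by apply: (@continuous_min _ _ idfun (cst n.+1%:R)); [exact: cvg_id|exact: cvg_cst].
exact: continuous_ppart.
Qed.

Lemma cutoff_ppart_trunc n : cutoff (ppart_trunc n).
Proof.
split; [exact: continuous_ppart_trunc|by move=> x; exact: ppart_ge0|].
exists n.+1%:R^-1; first by rewrite invr_gt0.
move=> x xn; rewrite /ppart_trunc/ppart max_r// subr_le0.
by rewrite ge_min xn.
Qed.

(** [n.+1 * n.+1] steps of height [1 / n.+1] reach the truncation level [n.+1], and the rounding
    loss is exactly the shift in [ppart_trunc]. *)
Lemma ppart_trunc_le_staircase n x :
  ppart_trunc n x <= staircase n.+1%:R^-1 (n.+1 * n.+1) x.
Proof.
rewrite ge_max staircase_ge0 ?invr_ge0// andbT.
apply: le_trans (staircase_ge _ _ _); last by rewrite invr_ge0.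
rewrite lerD2r le_min !ge_min lexx/=; apply/orP; right.
by rewrite -(natr1 (n.+1 * n.+1)) mulrDl natrM mulfK ?pnatr_eq0// lerDl mul1r invr_ge0.
Qed.

Lemma le_jump_sum (phi psi : R -> R) f t : (forall x, phi x <= psi x) ->
  (jump_sum phi (cst 1%R) f t <= jump_sum psi (cst 1%R) f t)%E.
Proof. by move=> pp; apply: le_esum => u _; rewrite lee_fin !mulr1. Qed.

Lemma jump_sum_ge0 (phi : R -> R) f t : (forall x, 0 <= phi x) ->
  (0 <= jump_sum phi (cst 1%R) f t)%E.
Proof. by move=> p0; apply: esum_ge0 => u _; rewrite lee_fin mulr1. Qed.

Lemma jump_sum_ppart_cvg f t :
  jump_sum (ppart_trunc n) (cst 1%R) f t @[n --> \oo] --> jump_sum ppart (cst 1%R) f t.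
Proof.
apply: esum_nondecreasing_cvg => [n u _|u _ m n mn|u _].
- by rewrite mulr1 lee_fin ppart_ge0.
- by rewrite !mulr1 lee_fin ppart_trunc_homo.
- rewrite mulr1; under eq_fun do rewrite mulr1.
  by apply: cvg_EFin; [exact: nearW|exact: ppart_trunc_cvg].
Qed.

End jump_sums.

(* Sandwiching the positive part between two staircases reduces the first
   moment of the jumps to the intensities of the half-lines. *)
Section jump_moment.
Context d d' (S : measurableType d) (S' : measurableType d') (R : realType)
  (P : probability S R).
Variables (Y : R -> S -> R) (t : R)
  (mu : {measure set S' -> \bar R}) (g : S' -> R).
Hypotheses (mg : measurable_fun setT g) (mY : forall u, measurable_fun setT (Y u))
  (cY : forall w, rcll (Y^~ w)) (t0 : 0 <= t)
  (intensity : forall c : R, 0 < c ->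
    (\int[P]_w jump_sum (above c) (cst 1%R) (Y^~ w) t = t%:E * mu [set x | c < g x]%R)%E).

Let one_weight : [/\ measurable_fun setT (cst 1 : R -> R),
  forall x : R, 0 < x -> 0 <= (cst 1 x : R) &
  forall x : R, 0 < x -> {for x, continuous (cst 1 : R -> R)}].
Proof. by split=> // x _; exact: cvg_cst. Qed.

Let at_t (phi : R -> R) :
  measurable_fun setT (fun p : S * R => jump_sum phi (cst 1) (Y^~ p.1) p.2) ->
  measurable_fun setT (fun w => jump_sum phi (cst 1) (Y^~ w) t).
Proof. by move=> /(measurable_fun_pair1 t). Qed.

Let m_above c : 0 < c ->
  measurable_fun setT (fun w => jump_sum (above c) (cst 1) (Y^~ w) t).
Proof.
by have [? ? ?] := one_weight => c0; apply: at_t; exact: measurable_jump_sum_above.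
Qed.

Let m_trunc n :
  measurable_fun setT (fun w => jump_sum (ppart_trunc n) (cst 1) (Y^~ w) t).
Proof.
have [? ? ?] := one_weight; apply: at_t; apply: measurable_esum_cutoff => //.
exact: cutoff_ppart_trunc.
Qed.

Lemma measurable_jump_moment :
  measurable_fun setT (fun w => jump_sum ppart (cst 1) (Y^~ w) t).
Proof.
by have [? ? ?] := one_weight; apply: at_t; exact: measurable_jump_sum_ppart.
Qed.

Let m_stair e K : 0 < e ->
  measurable_fun setT (fun w => jump_sum (staircase e K) (cst 1) (Y^~ w) t).
Proof.
move=> e0; under eq_fun do rewrite jump_sum_staircase ?ltW//.
apply: emeasurable_sum => k; apply: emeasurable_funM => //.
by apply: m_above; rewrite mulr_gt0.
Qed.

Let ma c : measurable_fun setT (above c \o g).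
Proof. by apply: measurableT_comp => //; rewrite aboveE set_above; exact: measurable_indic. Qed.

Let mstair e K : measurable_fun setT (staircase e K \o g).
Proof.
apply: (measurableT_comp _ mg); apply: measurable_sum => k; apply: measurable_funM => //.
by rewrite aboveE set_above; exact: measurable_indic.
Qed.

Lemma integral_staircase (e : R) K : 0 < e ->
  (\int[P]_w jump_sum (staircase e K) (cst 1%R) (Y^~ w) t =
   t%:E * \int[mu]_x (staircase e K (g x))%:E)%E.
Proof.
move=> e0; have above0 c x : 0 <= above c x :> R by rewrite /above; case: ifP.
have ke (k : nat) : 0 < k.+1%:R * e by rewrite mulr_gt0.
transitivity (\sum_(k < K) e%:E * (t%:E * mu [set x | k.+1%:R * e < g x]%R))%E.
  under eq_integral do rewrite jump_sum_staircase ?ltW//.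
  rewrite ge0_integral_sum//; last 2 first.
  - by move=> k; apply: emeasurable_funM => //; exact: m_above.
  - by move=> k w _; apply: mule_ge0; [rewrite lee_fin ltW|exact: jump_sum_ge0].
  apply: eq_bigr => k _; rewrite ge0_integralZl//; last 3 first.
  - exact: m_above.
  - by move=> w _; exact: jump_sum_ge0.
  - by rewrite lee_fin ltW.
  by rewrite intensity.
under eq_bigr do rewrite muleCA.
rewrite -ge0_sume_distrr; last by move=> k _; apply: mule_ge0; [rewrite lee_fin ltW|exact: measure_ge0].
congr (_ * _)%E.
under [RHS]eq_integral do rewrite /staircase -sumEFin.
rewrite ge0_integral_sum//; last 2 first.
- by move=> k; apply/measurable_EFinP; apply: measurable_funM => //; exact: (ma (k.+1%:R * e)).
- by move=> k x _; rewrite lee_fin mulr_ge0// ltW.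
apply: eq_bigr => k _.
under eq_integral do rewrite EFinM.
rewrite ge0_integralZl//; last 3 first.
- by apply/measurable_EFinP; exact: (ma (k.+1%:R * e)).
- by move=> x _; rewrite lee_fin.
- by rewrite lee_fin ltW.
congr (_ * _)%E; rewrite -(setIT [set x | _]) -integral_indic//; last first.
  rewrite -[X in measurable X]setTI; apply: (mg measurableT (Y := [set y | k.+1%:R * e < y])).
  by rewrite set_above.
by apply: eq_integral => x _; rewrite aboveE !indicE.
Qed.

(** The chain [ppart_trunc n <= staircase <= ppart] is used on both sides. The staircases have
    matching integrals, so each truncated integral is below the full integral of the other side, and
    letting [n] grow gives both inequalities. The map [g] will be the identity for upward jumps and
    the opposite for downward ones. *)
Lemma integral_jump_moment :
  (\int[P]_w jump_sum ppart (cst 1%R) (Y^~ w) t =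
   t%:E * \int[mu]_x (ppart (g x))%:E)%E.
Proof.
have e0 (n : nat) : 0 < n.+1%:R^-1 :> R by rewrite invr_gt0.
have mpp : measurable_fun setT (fun x : S' => (ppart (g x))%:E).
  by apply/measurable_EFinP; apply: measurableT_comp mg; exact: (continuous_measurable_fun (@continuous_ppart R)).
have mpt n : measurable_fun setT (fun x : S' => (ppart_trunc n (g x))%:E).
  by apply/measurable_EFinP; apply: measurableT_comp mg; exact: (continuous_measurable_fun (@continuous_ppart_trunc R n)).
have L : (\int[P]_w jump_sum (ppart_trunc n) (cst 1%R) (Y^~ w) t)%E @[n --> \oo] -->
    (\int[P]_w jump_sum ppart (cst 1%R) (Y^~ w) t)%E.
  apply: cvg_ge0_integral => [//|n w|w m n mn|w].
  - by apply: jump_sum_ge0 => x; exact: ppart_ge0.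
  - by apply: le_jump_sum => x; exact: ppart_trunc_homo.
  - exact: jump_sum_ppart_cvg.
have M : (\int[mu]_x (ppart_trunc n (g x))%:E)%E @[n --> \oo] -->
    (\int[mu]_x (ppart (g x))%:E)%E.
  apply: cvg_ge0_integral => [//|n x|x m n mn|x].
  - by rewrite lee_fin ppart_ge0.
  - by rewrite lee_fin ppart_trunc_homo.
  - by apply: cvg_EFin; [exact: nearW|exact: ppart_trunc_cvg].
apply/eqP; rewrite eq_le; apply/andP; split.
  rewrite -(cvg_lim _ L)//; apply: lime_le; first by apply/cvg_ex; eexists; exact: L.
  apply: nearW => n.
  apply: (@le_trans _ _ (\int[P]_w jump_sum (staircase n.+1%:R^-1 (n.+1 * n.+1)) (cst 1%R) (Y^~ w) t)%E).
    apply: ge0_le_integral => //.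
    - by move=> w _; apply: jump_sum_ge0 => x; exact: ppart_ge0.
    - exact: m_stair.
    - by move=> w _; apply: le_jump_sum => x; exact: ppart_trunc_le_staircase.
  rewrite integral_staircase//; apply: lee_wpmul2l; first by rewrite lee_fin.
  apply: ge0_le_integral => //.
  - by move=> x _; rewrite lee_fin staircase_ge0.
  - by apply/measurable_EFinP; exact: mstair.
  - by move=> x _; rewrite lee_fin staircase_le.
have M' : (t%:E * \int[mu]_x (ppart_trunc n (g x))%:E)%E @[n --> \oo] -->
    (t%:E * \int[mu]_x (ppart (g x))%:E)%E by apply: cvgeZl.
rewrite -(cvg_lim _ M')//; apply: lime_le; first by apply/cvg_ex; eexists; exact: M'.
apply: nearW => n.
apply: (@le_trans _ _ (\int[P]_w jump_sum (staircase n.+1%:R^-1 (n.+1 * n.+1)) (cst 1%R) (Y^~ w) t)%E).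
  rewrite integral_staircase//; apply: lee_wpmul2l; first by rewrite lee_fin.
  apply: ge0_le_integral => //.
  - by move=> x _; rewrite lee_fin ppart_ge0.
  - by apply/measurable_EFinP; exact: mstair.
  - by move=> x _; rewrite lee_fin ppart_trunc_le_staircase.
apply: ge0_le_integral => //.
- by move=> w _; apply: jump_sum_ge0 => x; rewrite staircase_ge0 ?ltW.
- exact: m_stair.
- exact: measurable_jump_moment.
- by move=> w _; apply: le_jump_sum => x; rewrite staircase_le ?ltW.
Qed.

End jump_moment.

Lemma ae_eq_integrable d (S : measurableType d) (R : realType)
    (mu : {measure set S -> \bar R}) (f g : S -> \bar R) :
  measurable_fun setT f -> ae_eq mu setT f g ->
  mu.-integrable setT g -> mu.-integrable setT f.
Proof.
move=> mf fg /integrableP[mg intg]; apply/integrableP; split => //.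
rewrite (ae_eq_integral (abse \o g))//.
- exact: measurableT_comp.
- exact: measurableT_comp.
- by apply: filterS fg => x H /H /= ->.
Qed.

Lemma integral_prob_cst d (S : measurableType d) (R : realType)
    (P : probability S R) (c : R) : (\int[P]__ c%:E = c%:E)%E.
Proof.
by rewrite integral_cst// -[RHS]mule1; congr (_ * _)%E; exact: probability_setT.
Qed.

(** * Integrability and mean of X *)

Section fv_levy_mean.
Context d (Omega : measurableType d) (R : realType) (P : probability Omega R).
Variables (T : R) (X : R -> {RV P >-> R}) (lambda : R)
  (nu : {measure set (measurableTypeR R) -> \bar R}).
Hypotheses (T0 : 0 < T) (fvX : fv_levy_process T X lambda nu)
  (big : nu.-integrable [set x | 1 <= `|x|] (fun x => x%:E)).

Definition mean_rate : R := lambda + \int[nu]_(x in [set x | 1 <= `|x|]) x.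

Let absS : [set: R] = [set x | `|x| < 1] `|` [set x | 1 <= `|x|].
Proof.
by apply/seteqP; split => // x _ /=; case: (ltP `|x| 1); [left|right].
Qed.

Let absD : [disjoint [set x : R | (`|x| < 1)%R] & [set x : R | (1 <= `|x|)%R]]%classic.
Proof.
by apply/disj_setPS => x /= [x1]; rewrite leNgt x1.
Qed.

Let m_small : measurable [set x : measurableTypeR R | `|x| < 1].
Proof.
rewrite (_ : mkset _ = `]-1, 1[%classic)//.
by apply/seteqP; split => x /=; rewrite in_itv/= ltr_norml.
Qed.

Let m_big : measurable [set x : measurableTypeR R | 1 <= `|x|].
Proof.
rewrite (_ : mkset _ = ~` [set x : measurableTypeR R | `|x| < 1]).
  exact: measurableC.
by apply/seteqP; split => x /=; rewrite leNgt => /negP.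
Qed.

Lemma integrable_levy_measure : nu.-integrable setT (fun x => x%:E).
Proof.
apply/integrableP; split; first exact/measurable_EFinP.
rewrite absS ge0_integral_setU//=; last first.
  by apply: measurable_funTS; apply: measurableT_comp => //; exact/measurable_EFinP.
apply: lte_add_pinfty.
  by have /integrableP[] := fvl_small_jumps fvX.
by have /integrableP[] := big.
Qed.

Lemma mean_rateE : mean_rate = fv_drift lambda nu + \int[nu]_x x.
Proof.
rewrite absS Rintegral_setU//; last by rewrite -absS; exact: integrable_levy_measure.
by rewrite /mean_rate /fv_drift; ring.
Qed.

Section fixed_time.
Variable t : R.
Hypothesis tT : 0 <= t <= T.

Let Y u : Omega -> R := X (clamp t u).

Let mY u : measurable_fun setT (Y u). Proof. exact: measurable_funP. Qed.

Let cY w : rcll (Y^~ w).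
Proof. exact: (rcll_clamp (levy_cadlag (fvl_levy fvX) w)). Qed.

Let jumpY w u : 0 < u <= t -> jump (Y^~ w) u = jump (X^~ w) u.
Proof. exact: (@jump_clamp _ (X^~ w)). Qed.

Let jump_countY w A : jump_count (Y^~ w) t A = jump_count (X^~ w) t A.
Proof.
rewrite /jump_count; congr counting; apply/seteqP; split => u /= [u0 ut].
  by rewrite jumpY ?u0.
by rewrite -jumpY ?u0.
Qed.

Let cNY w : rcll ((fun u => \- Y u)^~ w).
Proof. exact: (rcllN (cY w)). Qed.

Let t0 : 0 <= t. Proof. by case/andP: tT. Qed.

Let up w := jump_sum ppart (cst 1) (Y^~ w) t.
Let dn w := jump_sum ppart (cst 1) (\- Y^~ w) t.

Let integral_up : (\int[P]_w up w = t%:E * \int[nu]_x (ppart x)%:E)%E.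
Proof.
apply: (@integral_jump_moment _ _ _ _ _ _ Y t nu idfun) => //.
  exact: measurable_id.
move=> c c0.
under eq_integral do rewrite -jump_count_above// jump_countY.
apply: (fvl_jump_intensity fvX) => //.
by rewrite (set_above c : [set x | c < idfun x] = _).
Qed.

Let integral_dn : (\int[P]_w dn w = t%:E * \int[nu]_x (ppart (- x))%:E)%E.
Proof.
apply: (@integral_jump_moment _ _ _ _ _ _ (fun u => \- Y u) t nu -%R) => // c c0.
transitivity (\int[P]_w jump_count (X^~ w) t [set x | x < - c]%R)%E.
  by apply: eq_integral => w _; rewrite -jump_countY jump_count_below.
rewrite (fvl_jump_intensity fvX)//.
  by congr (_ * nu _)%E; apply/seteqP; split => x /=; rewrite ltrNr.
rewrite (_ : mkset _ = `]-oo, - c[%classic)//.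
Qed.

Let I : \bar R := (\int[nu]_x `|x%:E|)%E.

Let I_fin : (I < +oo)%E.
Proof. by have /integrableP[] := integrable_levy_measure. Qed.

Let ppart_int (s : R -> R) : measurable_fun setT s -> (forall x, s x <= `|x|) ->
  (0 <= \int[nu]_x (ppart (s x))%:E <= I)%E.
Proof.
move=> ms sx; apply/andP; split.
  by apply: integral_ge0 => x _; rewrite lee_fin ppart_ge0.
apply: ge0_le_integral => //.
- by move=> x _; rewrite lee_fin ppart_ge0.
- apply/measurable_EFinP; apply: measurableT_comp ms.
  exact: (continuous_measurable_fun (@continuous_ppart R)).
- by apply: measurableT_comp => //; exact/measurable_EFinP.
- by move=> x _; rewrite lee_fin ge_max sx normr_ge0.
Qed.

Let m_up : measurable_fun setT up. Proof. exact: measurable_jump_moment. Qed.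

Let m_dn : measurable_fun setT dn.
Proof. exact: (@measurable_jump_moment _ _ _ (fun u => \- Y u)). Qed.

Let up0 w : (0 <= up w)%E.
Proof. by apply: jump_sum_ge0 => x; exact: ppart_ge0. Qed.

Let dn0 w : (0 <= dn w)%E.
Proof. by apply: jump_sum_ge0 => x; exact: ppart_ge0. Qed.

Let up_le : (\int[P]_w up w <= t%:E * I)%E.
Proof.
rewrite integral_up lee_wpmul2l ?lee_fin//.
have H := @ppart_int id (@measurable_id _ _ _) (@ler_norm R).
by case/andP: H.
Qed.

Let dn_le : (\int[P]_w dn w <= t%:E * I)%E.
Proof.
rewrite integral_dn lee_wpmul2l ?lee_fin//.
have H : forall x : R, - x <= `|x| by move=> x; rewrite -normrN ler_norm.
by case/andP: (@ppart_int -%R (@oppr_measurable _ _) H).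
Qed.

Let tI_fin : (t%:E * I < +oo)%E.
Proof. by rewrite lte_mul_pinfty. Qed.

Let up_int : P.-integrable setT up.
Proof.
apply/integrableP; split => //; under eq_integral do rewrite gee0_abs//.
exact: le_lt_trans up_le tI_fin.
Qed.

Let dn_int : P.-integrable setT dn.
Proof.
apply/integrableP; split => //; under eq_integral do rewrite gee0_abs//.
exact: le_lt_trans dn_le tI_fin.
Qed.

(** [rsum] takes [fine] of a difference that might be infinite. Integrability makes [up] and [dn]
    finite almost surely, and there the Levy-Ito sum is a genuine difference. *)
Let X_updn : ae_eq P setT (EFin \o X t)
  (fun w => (fv_drift lambda nu * t)%:E + (up w - dn w))%E.
Proof.
have ufin := integrable_ae measurableT up_int.
have dfin := integrable_ae measurableT dn_int.
apply: filterS3 (fvl_levy_ito fvX) ufin dfin => w /(_ _ tT) Xw /(_ Logic.I) uw /(_ Logic.I) dw _ /=.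
rewrite Xw EFinD; congr (_ + _)%E.
have -> : rsum [set s | 0 < s <= t] (jump (X^~ w)) =
    rsum [set s | 0 < s <= t] (fun u => jump (Y^~ w) u * cst 1 u).
  rewrite /rsum; congr (fine (_ - _)); apply: eq_esum => u /= ut.
    by rewrite /funrpos mulr1 jumpY.
  by rewrite /funrneg mulr1 jumpY.
by rewrite rsum_jump// fineK// fin_numB; apply/andP; split.
Qed.

Let drift_int : P.-integrable setT (cst (fv_drift lambda nu * t)%:E).
Proof. exact: finite_measure_integrable_cst. Qed.

Let sum_int : P.-integrable setT
  (fun w => (fv_drift lambda nu * t)%:E + (up w - dn w))%E.
Proof. by apply: integrableD => //; exact: integrableB. Qed.

Let mX : measurable_fun setT (EFin \o X t).
Proof. exact/measurable_EFinP. Qed.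

Lemma levy_integrable : P.-integrable setT (EFin \o X t).
Proof.
exact: ae_eq_integrable X_updn sum_int.
Qed.

Lemma levy_expectation : (\int[P]_w (X t w)%:E = (mean_rate * t)%:E)%E.
Proof.
rewrite (ae_eq_integral _ _ measurableT mX (measurable_int _ sum_int) X_updn).
rewrite integralD//; last exact: integrableB.
rewrite integralB// integral_prob_cst integral_up integral_dn.
rewrite mean_rateE /Rintegral.
have -> : (\int[nu]_x x%:E = \int[nu]_x (ppart x)%:E - \int[nu]_x (ppart (- x))%:E)%E.
  rewrite integralE; congr (_ - _)%E; apply: eq_integral => x _.
    by rewrite funeposE /ppart -EFin_max.
  by rewrite funenegE /ppart -EFin_max.
have fin_part (s : R -> R) : measurable_fun setT s -> (forall x, s x <= `|x|) ->
    (\int[nu]_x (ppart (s x))%:E)%E \is a fin_num.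
  move=> ms sx; have /andP[p0 pI] := ppart_int ms sx.
  by rewrite ge0_fin_numE// (le_lt_trans pI).
have fu := fin_part id (@measurable_id _ _ _) (@ler_norm R).
have fd : (\int[nu]_x (ppart (- x))%:E)%E \is a fin_num.
  apply: (fin_part -%R (@oppr_measurable _ _)).
  by move=> x; rewrite -normrN ler_norm.
rewrite -(fineK fu) -(fineK fd) -!EFinM -!EFinB -EFinD; congr EFin.
rewrite /=; ring.
Qed.

Lemma levy_norm_bound : (\int[P]_w `|X t w|%:E <=
  (`|fv_drift lambda nu| * T)%:E + (T%:E * I + T%:E * I))%E.
Proof.
have [t0' tT'] := andP tT.
have int0 := integralD measurableT up_int dn_int.
have tTI : (t%:E * I <= T%:E * I)%E.
  by apply: lee_wpmul2r; rewrite ?lee_fin//; apply: integral_ge0.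
apply: (@le_trans _ _ (\int[P]_w ((`|fv_drift lambda nu| * T)%:E + (up w + dn w)))%E).
  apply: ae_ge0_le_integral => //.
  - by apply/measurable_EFinP; apply: measurableT_comp.
  - move=> w _; apply: adde_ge0; [|exact: adde_ge0]. by rewrite lee_fin mulr_ge0// ltW.
  - by apply: emeasurable_funD => //; exact: emeasurable_funD.
  - apply: filterS X_updn => w /(_ Logic.I)/= Xw _.
    rewrite -abse_EFin Xw (le_trans (lee_abs_add _ _))//; apply: leeD.
      by rewrite abse_EFin lee_fin normrM (ger0_norm t0') ler_wpM2l.
    by rewrite (le_trans (lee_abs_sub _ _))// !gee0_abs.
rewrite integralD//; last 2 first.
- exact: finite_measure_integrable_cst.
- exact: integrableD.
rewrite integral_prob_cst leeD// int0 leeD//.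
  exact: le_trans up_le tTI.
exact: le_trans dn_le tTI.
Qed.

End fixed_time.

(** The bound is uniform in time, so that X contributes only a constant to the estimate behind
    Fubini's theorem. *)
Lemma levy_uniform_bound : exists C : R, forall t, 0 <= t <= T ->
  (\int[P]_w `|X t w|%:E <= C%:E)%E.
Proof.
have I_fin : (\int[nu]_x `|x%:E|)%E \is a fin_num.
  have /integrableP[_ I_fin] := integrable_levy_measure.
  by rewrite ge0_fin_numE//; apply: integral_ge0.
pose a := fine (\int[nu]_x `|x%:E|)%E; exists (`|fv_drift lambda nu| * T + (T * a + T * a)).
move=> t tT; rewrite (le_trans (levy_norm_bound tT))// EFinD leeD2l//.
by rewrite EFinD EFinM /a fineK.
Qed.

End fv_levy_mean.

(** * Conditioned Gaussian pairs *)

Section density_change_of_variables.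
Import HBNNSimple.
Local Open Scope ereal_scope.
Context d d' (S : measurableType d) (S' : measurableType d') (R : realType).
Variables (mu : {measure set S -> \bar R}) (nu : {measure set S' -> \bar R})
  (phi : S -> S') (g : S -> R).
Hypotheses (mphi : measurable_fun setT phi) (mg : measurable_fun setT g)
  (g0 : forall x, (0 <= g x)%R)
  (nuE : forall A, measurable A -> nu A = \int[mu]_x (\1_A (phi x) * g x)%:E).

Let density_nnsfun (h : {nnsfun S' >-> R}) :
  \int[nu]_y (h y)%:E = \int[mu]_x (h (phi x) * g x)%:E.
Proof.
transitivity (\int[nu]_y (\sum_(r \in range h) (r * \1_(h @^-1` [set r]) y)%:E)).
  by apply: eq_integral => y _; rewrite fsumEFin// -fimfunE.
rewrite ge0_integral_fsum//; last 2 first.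
- by move=> r; apply/measurable_EFinP; exact: measurable_funM.
- by move=> r y _; exact: nnfun_muleindic_ge0.
transitivity (\int[mu]_x (\sum_(r \in range h)
    (r * \1_(h @^-1` [set r]) (phi x))%:E * (g x)%:E)); last first.
  apply: eq_integral => x _; rewrite -ge0_mule_fsuml; last first.
    by move=> r; exact: nnfun_muleindic_ge0.
  by rewrite fsumEFin// -fimfunE.
have m1 r : measurable_fun setT (fun x => \1_(h @^-1` [set r]) (phi x) : R).
  by apply: measurableT_comp => //; exact: measurable_indic.
rewrite ge0_integral_fsum//; last 2 first.
- move=> r; apply: emeasurable_funM; last exact/measurable_EFinP.
  by apply/measurable_EFinP; exact: measurable_funM.
- by move=> r x _; apply: mule_ge0; [exact: nnfun_muleindic_ge0|rewrite lee_fin].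
apply: eq_fsbigr => r; rewrite inE => -[y _ hy].
have r0 : (0 <= r)%R by rewrite -hy.
under eq_integral do rewrite EFinM.
rewrite integralZl_indic_nnsfun// integral_indic// setIT nuE//.
rewrite -ge0_integralZl//; last 2 first.
- by apply/measurable_EFinP; exact: measurable_funM.
- by move=> x _; rewrite lee_fin mulr_ge0.
by apply: eq_integral => x _; rewrite -!EFinM mulrA.
Qed.

(** Here [nu] is the image by [phi] of the measure with density [g]. One statement serves the normal
    density ([phi] the identity), laws under P restricted to an event ([g] an indicator) and image
    laws scaled by a constant. *)
Lemma ge0_integral_density (f : S' -> \bar R) :
  measurable_fun setT f -> (forall y, 0 <= f y) ->
  \int[nu]_y f y = \int[mu]_x (f (phi x) * (g x)%:E).
Proof.
move=> mf f0; pose h := nnsfun_approx measurableT mf.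
have hf y : (h n y)%:E @[n --> \oo] --> f y.
  by apply: (@cvg_nnsfun_approx _ _ _ _ measurableT _ mf) => // x _.
have hmono y : {homo (fun n => (h n y)%:E) : m n / (m <= n)%N >-> m <= n}.
  by move=> m n mn; rewrite lee_fin; exact/lefP/nd_nnsfun_approx.
have L : \int[nu]_y (h n y)%:E @[n --> \oo] --> \int[nu]_y f y.
  rewrite (_ : \int[nu]_y f y = \int[nu]_y (fun y => limn (fun n => (h n y)%:E)) y).
    apply: cvg_monotone_convergence => [//|n|n y _|y _].
    - exact/measurable_EFinP.
    - by rewrite lee_fin.
    - exact: hmono.
  by apply: eq_integral => y _; apply/esym/cvg_lim => //; exact: hf.
apply: (cvg_unique _ L) => //.
rewrite (_ : (fun n => _) = (fun n => \int[mu]_x (h n (phi x) * g x)%:E)); last first.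
  by apply/funext => n; exact: density_nnsfun.
rewrite (_ : \int[mu]_x (f (phi x) * (g x)%:E) =
   \int[mu]_x (fun x => limn (fun n => (h n (phi x) * g x)%:E)) x).
  apply: cvg_monotone_convergence => [//|n|n x _|x _ m n mn].
  - apply/measurable_EFinP; apply: measurable_funM => //.
    exact: measurableT_comp.
  - by rewrite lee_fin mulr_ge0.
  - rewrite !EFinM lee_wpmul2r ?lee_fin//.
    by have := hmono (phi x) m n mn; rewrite lee_fin.
apply: eq_integral => x _; apply/esym/cvg_lim => //.
under eq_fun do rewrite EFinM.
by apply: cvgeZr => //; exact: hf.
Qed.

End density_change_of_variables.

(** * Reflections preserving Lebesgue measure *)

Section reflection.
Local Open Scope ereal_scope.
Context {R : realType}.
Notation mu := (@lebesgue_measure R).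

Lemma lebesgue_integral_reflect (c : R) (f : R -> \bar R) :
  measurable_fun setT f -> (forall x, 0 <= f x) ->
  \int[mu]_x f (c - x)%R = \int[mu]_x f x.
Proof.
move=> mf f0; have mc : measurable_fun setT (fun x : measurableTypeR R => c - x : measurableTypeR R)%R.
  exact: measurable_funB.
have f0' : {in [set: measurableTypeR R], forall y, 0 <= f y} by move=> y _.
have E := ge0_integral_pushforward mc mu measurableT mf f0'.
rewrite preimage_setT in E; rewrite -[LHS]E.
apply: eq_measure_integral => //= A mA _; apply/esym.
apply: lebesgue_measure_unique => // _ [[a b]] _ <-.
(* The reflection exchanges the closed and the open end of the interval but keeps its length. *)
rewrite /= /pushforward (_ : _ @^-1` _ = `[c - b, c - a[%classic)%R.
  rewrite !lebesgue_measure_itv/= !lte_fin ltrD2l ltrN2.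
  by case: ifP => // _; rewrite -!EFinD; congr EFin; ring.
by apply/seteqP; split => x /=; rewrite !in_itv/= => /andP[? ?]; apply/andP; split; lra.
Qed.

(** A translation is the composition of two reflections. *)
Lemma lebesgue_integral_shift (c : R) (f : R -> \bar R) :
  measurable_fun setT f -> (forall x, 0 <= f x) ->
  \int[mu]_x f (x - c)%R = \int[mu]_x f x.
Proof.
move=> mf f0; rewrite -(lebesgue_integral_reflect 0 mf f0).
rewrite -(lebesgue_integral_reflect c (f := fun x => f (0 - x)%R))//.
  by apply: eq_integral => x _; congr f; ring.
by apply: measurableT_comp => //; exact: measurable_funB.
Qed.

End reflection.

Section shear.
Local Open Scope ereal_scope.
Context {R : realType}.
Notation mu := (@lebesgue_measure R).
Variable J : R * R -> \bar R.
Hypotheses (mJ : measurable_fun setT J) (J0 : forall p, 0 <= J p).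

Let m_shear : measurable_fun setT (fun p : R * R => J (p.1, p.2 - p.1)%R).
Proof.
apply: (measurableT_comp mJ (g := fun p : R * R => (p.1, p.2 - p.1)%R)).
apply: measurable_fun_pair; first exact: measurable_fst.
by apply: measurable_funB; [exact: measurable_snd|exact: measurable_fst].
Qed.

(** Translating [v] by [u] for fixed [u], then exchanging the integrals, makes the sum [z] the outer
    variable. *)
Lemma integral_shear :
  \int[mu]_u \int[mu]_v J (u, v) = \int[mu]_z \int[mu]_u J (u, z - u)%R.
Proof.
transitivity (\int[mu]_u \int[mu]_z J (u, z - u)%R).
  apply: eq_integral => u _.
  by rewrite (lebesgue_integral_shift u (f := fun v => J (u, v)))//; exact: measurable_fun_pair2.
exact: (@fubini_tonelli _ _ (measurableTypeR R) (measurableTypeR R) R mu mu _ m_shear (fun p => J0 _)).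
Qed.

End shear.

Section reflect_along_sum.
Local Open Scope ereal_scope.
Context {R : realType}.
Notation mu := (@lebesgue_measure R).
Variable J : R * R -> \bar R.
Hypotheses (mJ : measurable_fun setT J) (J0 : forall p, 0 <= J p).

Definition sum_reflection (c : R) (p : R * R) : R * R :=
  (c * (p.1 + p.2) - p.1, (p.1 + p.2) - (c * (p.1 + p.2) - p.1))%R.

Lemma measurable_sum_reflection c : measurable_fun setT (sum_reflection c).
Proof.
have m1 := @measurable_fst _ _ (measurableTypeR R) (measurableTypeR R).
have m2 := @measurable_snd _ _ (measurableTypeR R) (measurableTypeR R).
have ms : measurable_fun setT (fun p : measurableTypeR R * measurableTypeR R => p.1 + p.2)%R by exact: measurable_funD.
by apply: measurable_fun_pair; repeat (apply: measurable_funB || apply: measurable_funM || exact: ms || exact: m1 || exact: measurable_cst).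
Qed.

(* For fixed sum z = u + v the reflection u -> c z - u preserves Lebesgue measure. *)
Lemma integral_sum_reflection c :
  \int[mu]_u \int[mu]_v J (u, v) = \int[mu]_u \int[mu]_v J (sum_reflection c (u, v)).
Proof.
have mJ' : measurable_fun setT (J \o sum_reflection c).
  by apply: measurableT_comp mJ _; exact: measurable_sum_reflection.
rewrite integral_shear//.
rewrite (@integral_shear _ (J \o sum_reflection c))//=.
apply: eq_integral => z _.
rewrite -(lebesgue_integral_reflect (c * z)%R (f := fun u => J (u, z - u)%R))//.
  by apply: eq_integral => u _; rewrite /sum_reflection/= subrKC.
have mg : measurable_fun setT (fun u : measurableTypeR R => (u, z - u)%R : measurableTypeR R * measurableTypeR R).
  by apply: measurable_fun_pair => //; exact: measurable_funB.
exact: measurableT_comp mJ mg.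
Qed.

End reflect_along_sum.

(** * Gaussian symmetry and first absolute moment *)

Section gaussian.
Local Open Scope ereal_scope.
Context {R : realType}.
Notation mu := (@lebesgue_measure R).
Implicit Types (a b : R).

Lemma normal_pdf_sqrtE a x : (0 < a)%R ->
  normal_pdf 0 (Num.sqrt a) x =
  (normal_peak (Num.sqrt a) * expR (- (x ^+ 2 / (a *+ 2))))%R.
Proof.
move=> a0; rewrite normal_pdfE ?gt_eqF ?sqrtr_gt0// /normal_fun subr0 sqr_sqrtr ?ltW//.
by rewrite mulNr.
Qed.

(** With z = u + v, the exponent u^2/(2a) + v^2/(2b) equals z^2/(2(a+b)) + (a+b)/(2ab) (u -
    az/(a+b))^2, and bu - av = (a+b)(u - az/(a+b)). Reflecting u about az/(a+b), its conditional
    mean given z, preserves the former and negates the latter; this is [sum_reflection] with c =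
    2a/(a+b). *)
Lemma gaussian_bridge_symmetry a b (phi : R * R -> R) : (0 < a)%R -> (0 < b)%R ->
  measurable_fun setT phi -> (forall p, (0 <= phi p)%R) ->
  let p c x := normal_pdf 0 (Num.sqrt c) x in
  \int[mu]_u \int[mu]_v (p a u * p b v * phi (b * u - a * v, u + v))%:E =
  \int[mu]_u \int[mu]_v (p a u * p b v * phi (- (b * u - a * v), u + v))%:E.
Proof.
move=> a0 b0 mphi phi0 p.
pose J (q : R * R) := (p a q.1 * p b q.2 * phi (b * q.1 - a * q.2, q.1 + q.2)%R)%:E.
have mp c : measurable_fun setT (p c) by exact: measurable_normal_pdf.
have m1 := @measurable_fst _ _ (measurableTypeR R) (measurableTypeR R).
have m2 := @measurable_snd _ _ (measurableTypeR R) (measurableTypeR R).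
have mJ : measurable_fun setT J.
  apply/measurable_EFinP; apply: measurable_funM.
    by apply: measurable_funM; apply: measurableT_comp.
  apply: (measurableT_comp mphi (g := fun q : R * R => (b * q.1 - a * q.2, q.1 + q.2)%R)).
  apply: measurable_fun_pair; last exact: measurable_funD.
  by apply: measurable_funB; apply: measurable_funM.
have J0 q : 0 <= J q by rewrite lee_fin !mulr_ge0// normal_pdf_ge0.
rewrite [LHS](integral_sum_reflection mJ J0 (2 * a / (a + b))).
apply: eq_integral => u _; apply: eq_integral => v _.
have ab : (a + b != 0)%R by rewrite gt_eqF// addr_gt0.
rewrite /J /sum_reflection/=; congr ((_ * phi (_, _))%:E).
- rewrite /p !normal_pdf_sqrtE// mulrACA [RHS]mulrACA -!expRD; congr (_ * expR _)%R.
  field; rewrite ab !gt_eqF//.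
- by field.
- by field.
Qed.

Lemma ge0_integral_normal_prob c (f : R -> \bar R) : measurable_fun setT f ->
  (forall x, 0 <= f x) ->
  \int[normal_prob 0 (Num.sqrt c)]_x f x = \int[mu]_x (f x * (normal_pdf 0 (Num.sqrt c) x)%:E).
Proof.
move=> mf f0; apply: (@ge0_integral_density _ _ (measurableTypeR R) (measurableTypeR R) R mu
  (normal_prob 0 (Num.sqrt c)) idfun (normal_pdf 0 (Num.sqrt c))) => //.
- exact: measurable_id.
- exact: measurable_normal_pdf.
- by move=> x; exact: normal_pdf_ge0.
- move=> A mA; transitivity (\int[mu]_(x in A) (normal_pdf 0 (Num.sqrt c) x)%:E) => //; rewrite [LHS]integral_mkcond; apply: eq_integral => x _.
  by rewrite patchE indicE /=; case: ifP => _; rewrite ?mul1r ?mul0r.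
Qed.

(** The density is compared with that of variance [2 * a]: |x| p_a(x) <= sqrt(2a) p_{2a}(x)
    pointwise, and the right side integrates to sqrt(2a). The constant is not sharp; the order
    sqrt(a) is what matters. *)
Lemma normal_abs_moment a : (0 < a)%R ->
  \int[normal_prob 0 (Num.sqrt a)]_x (`|x|)%:E <= (Num.sqrt (2 * a))%:E.
Proof.
move=> a0; have a20 : (0 < 2 * a)%R by rewrite mulr_gt0.
rewrite ge0_integral_normal_prob//; last first.
  by apply/measurable_EFinP; exact: normr_measurable.
apply: (@le_trans _ _ (\int[mu]_x ((Num.sqrt (2 * a))%:E * (normal_pdf 0 (Num.sqrt (2 * a)) x)%:E))); last first.
  rewrite ge0_integralZl//; last 2 first.
  - by apply/measurable_EFinP; exact: measurable_normal_pdf.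
  - by move=> x _; rewrite lee_fin; exact: normal_pdf_ge0.
  by rewrite integral_normal_pdf mule1.
apply: ge0_le_integral => //.
- by move=> x _; rewrite -EFinM lee_fin mulr_ge0 ?normal_pdf_ge0.
- apply: emeasurable_funM; first by apply/measurable_EFinP; exact: normr_measurable.
  by apply/measurable_EFinP; exact: measurable_normal_pdf.
- apply: emeasurable_funM => //.
  by apply/measurable_EFinP; exact: measurable_normal_pdf.
move=> x _; rewrite -!EFinM lee_fin !normal_pdf_sqrtE//.
have peakE : (Num.sqrt (2 * a) * normal_peak (Num.sqrt (2 * a)) =
    Num.sqrt a * normal_peak (Num.sqrt a))%R.
  have sqrt_peak c : (0 < c)%R -> (Num.sqrt c * normal_peak (Num.sqrt c) = (Num.sqrt (pi *+ 2))^-1)%R.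
    move=> c0; rewrite /normal_peak sqr_sqrtr ?ltW// -mulrnAr sqrtrM ?ltW//.
    by rewrite invfM mulrA divff ?mul1r// gt_eqF// sqrtr_gt0.
  by rewrite !sqrt_peak.
rewrite [leRHS]mulrA peakE [leLHS]mulrCA -[leRHS]mulrA [leRHS]mulrCA.
rewrite ler_wpM2l ?normal_peak_ge0//.
set E := expR (- (x ^+ 2 / (2 * a *+ 2))).
have -> : expR (- (x ^+ 2 / (a *+ 2))) = (E * E)%R.
  by rewrite -expRD; congr expR; field; rewrite gt_eqF.
rewrite mulrA ler_wpM2r ?expR_ge0// /E expRN ler_pdivrMr ?expR_gt0//.
have t0 : (0 < Num.sqrt a)%R by rewrite sqrtr_gt0.
have at2 : a = (Num.sqrt a ^+ 2)%R by rewrite sqr_sqrtr// ltW.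
(* By 1 + y <= exp y it is enough that |x| <= sqrt(a) (1 + x^2/(4a)), where the difference is a
   square. *)
apply: (@le_trans _ _ (Num.sqrt a * (1 + x ^+ 2 / (2 * a *+ 2)))%R); last first.
  by rewrite ler_wpM2l ?sqrtr_ge0// expR_ge1Dx.
rewrite -real_normK ?num_real// {2}at2; move: (Num.sqrt a) `|x|%R t0 => t y t0.
rewrite -subr_ge0 (_ : _ - _ = (2 * t - y) ^+ 2 / (4 * t))%R; last first.
  by field; rewrite gt_eqF.
by rewrite divr_ge0 ?sqr_ge0// mulr_ge0 ?ltW.
Qed.

End gaussian.

Section conditioned_gaussian_pair.
Local Open Scope ereal_scope.
Context d (Omega : measurableType d) (R : realType) (P : probability Omega R).
Notation mu := (@lebesgue_measure R).
Variables (a b : R) (U V : Omega -> R) (E : set Omega).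
Hypotheses (a0 : (0 < a)%R) (b0 : (0 < b)%R).
Hypotheses (mU : measurable_fun setT U) (mV : measurable_fun setT V)
  (mE : measurable E).
Hypothesis law : forall A B : set R, measurable A -> measurable B ->
  P (E `&` (U @^-1` A `&` V @^-1` B)) =
  P E * (normal_prob 0 (Num.sqrt a) A * normal_prob 0 (Num.sqrt b) B).

Let p c (x : R) : R := normal_pdf 0 (Num.sqrt c) x.

Let UV w : measurableTypeR R * measurableTypeR R := (U w, V w).

Let mUV : measurable_fun setT UV. Proof. exact: measurable_fun_pair. Qed.

(** The law of [(U, V)] under P restricted to [E]; the long name is the measure structure carried by
    the pushforward. *)
Let kappa := measure_function_pushforward__canonical__measure_function_Measure
  (mrestr P mE) mUV.

Let kappaE C : kappa C = P (UV @^-1` C `&` E). Proof. by []. Qed.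

Let k : {nonneg R} := NngNum (fine_ge0 (measure_ge0 P E)).

Let kE : (k%:num)%:E = P E.
Proof. by rewrite /= fineK// fin_num_measure. Qed.

(** The hypothesis [law] gives equality on rectangles, which determine the product measure; the mass
    [P E] is put on the first factor. *)
Let kappa_prod C : measurable C ->
  (mscale k (normal_prob 0 (Num.sqrt a)) \x normal_prob 0 (Num.sqrt b)) C = kappa C.
Proof.
move=> mC; have H := (@product_measure_unique _ _ (measurableTypeR R) (measurableTypeR R) R
  (mscale k (normal_prob 0 (Num.sqrt a))) (normal_prob 0 (Num.sqrt b)) kappa); apply: H mC.
move=> A B mA mB.
transitivity (P E * (normal_prob 0 (Num.sqrt a) A * normal_prob 0 (Num.sqrt b) B)); last first.
  by rewrite muleA -kE.
by rewrite kappaE -law//; congr (P _); exact: setIC.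
Qed.

Lemma ge0_integral_gaussian_pair (f : measurableTypeR R * measurableTypeR R -> R) : measurable_fun setT f ->
  (forall q, (0 <= f q)%R) ->
  \int[P]_(w in E) (f (U w, V w))%:E =
  P E * \int[mu]_u \int[mu]_v (p a u * p b v * f (u, v))%:E.
Proof.
move=> mf f0.
have mfE : measurable_fun setT (EFin \o f) by exact/measurable_EFinP.
transitivity (\int[kappa]_q (f q)%:E).
  rewrite (@ge0_integral_density _ _ _ _ _ P kappa UV (\1_E))//.
    rewrite [LHS]integral_mkcond; apply: eq_integral => w _.
    by rewrite patchE indicE /=; case: ifP => _; rewrite ?mule1 ?mule0.
  move=> C mC; rewrite kappaE -(setIT (_ `&` _)) -integral_indic//; last first.
    by apply: measurableI => //; rewrite -[X in measurable X]setTI; exact: mUV.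
  by apply: eq_integral => w _; rewrite !indicE in_setI; case: (_ \in E); rewrite ?mulr1 ?mulr0 ?andbT ?andbF.
rewrite -(eq_measure_integral _ (fun C mC _ => kappa_prod mC)).
rewrite fubini_tonelli1//.
have mF := measurable_fun_fubini_tonelli_F (m2 := normal_prob 0 (Num.sqrt b)) (EFin \o f) mfE f0.
have F0 u : 0 <= fubini_F (normal_prob 0 (Num.sqrt b)) (EFin \o f) u.
  by apply: integral_ge0 => v _; rewrite lee_fin.
rewrite ge0_integral_mscale// kE; congr (_ * _).
rewrite ge0_integral_normal_prob//; apply: eq_integral => u _.
have mfu : measurable_fun setT (fun v => f (u, v)) by exact: measurable_fun_pair2.
rewrite /fubini_F ge0_integral_normal_prob//; last 2 first.
- exact/measurable_EFinP.
- by move=> v; rewrite lee_fin.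
rewrite -ge0_integralZr//; last 3 first.
- apply: emeasurable_funM; first exact/measurable_EFinP.
  by apply/measurable_EFinP; exact: measurable_normal_pdf.
- by move=> v _; rewrite mule_ge0// lee_fin// normal_pdf_ge0.
- by rewrite lee_fin normal_pdf_ge0.
by apply: eq_integral => v _; rewrite -!EFinM; congr EFin; rewrite /p; ring.
Qed.

Hypotheses (iU : P.-integrable setT (EFin \o U)) (iV : P.-integrable setT (EFin \o V)).

(** Changing the sign of bU - aV while keeping U + V exchanges its positive and negative parts on
    the event. Their integrals are thus equal, and finite by integrability. *)
Lemma gaussian_bridge_centered (B : set R) : measurable B ->
  \int[P]_(w in E `&` [set w | B (U w + V w)%R]) (b * U w - a * V w)%:E = 0.
Proof.
move=> mB; pose D := E `&` [set w | B (U w + V w)%R].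
have mUpV : measurable_fun setT (fun w => U w + V w)%R by exact: measurable_funD.
have mD : measurable D.
  by apply: measurableI => //; rewrite -[X in measurable X]setTI; exact: mUpV.
have iZ : P.-integrable setT (EFin \o (fun w => b * U w - a * V w)%R).
  apply: (eq_integrable measurableT ((fun w => b%:E * (U w)%:E) \- (fun w => a%:E * (V w)%:E))) => //.
  by apply: integrableB => //; exact: integrableZl.
(* The sign [s] selects the positive part ([1]) or the negative part ([-1]); the second coordinate
   carries the event on [U + V]. *)
pose phi (s : R) (q : measurableTypeR R * measurableTypeR R) : R := (ppart (s * q.1) * \1_B q.2)%R.
have mphi s : measurable_fun setT (phi s).
  apply: measurable_funM.
    apply: measurableT_comp (continuous_measurable_fun (@continuous_ppart R)) _.
    by apply: measurable_funM => //; exact: measurable_fst.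
  apply: measurableT_comp; last exact: measurable_snd.
  exact: measurable_indic.
have phi0 s q : (0 <= phi s q)%R by rewrite mulr_ge0// ppart_ge0.
pose f s (q : measurableTypeR R * measurableTypeR R) := phi s (b * q.1 - a * q.2, q.1 + q.2)%R.
have mf s : measurable_fun setT (f s).
  have m1 := @measurable_fst _ _ (measurableTypeR R) (measurableTypeR R).
  have m2 := @measurable_snd _ _ (measurableTypeR R) (measurableTypeR R).
  have mg : measurable_fun setT (fun q : measurableTypeR R * measurableTypeR R =>
      (b * q.1 - a * q.2, q.1 + q.2)%R : measurableTypeR R * measurableTypeR R).
    apply: measurable_fun_pair; last exact: measurable_funD.
    by apply: measurable_funB; apply: measurable_funM.
  exact: measurableT_comp (mphi s) mg.
have partE s : \int[P]_(w in D) (ppart (s * (b * U w - a * V w)))%:E =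
    P E * \int[mu]_u \int[mu]_v (p a u * p b v * f s (u, v))%:E.
  rewrite -ge0_integral_gaussian_pair//; last by move=> q; exact: phi0.
  rewrite [LHS]integral_mkcond [RHS]integral_mkcond; apply: eq_integral => w _.
  rewrite !patchE in_setI /f /phi indicE/=.
  rewrite (_ : (w \in [set w | B (U w + V w)%R]) = ((U w + V w)%R \in B)); last first.
    by apply/idP/idP; rewrite !inE.
  by case: (w \in E) => //=; case: (_ \in B); rewrite ?mulr1 ?mulr0.
have sym : \int[P]_(w in D) (ppart (1 * (b * U w - a * V w)))%:E =
    \int[P]_(w in D) (ppart (-1 * (b * U w - a * V w)))%:E.
  rewrite !partE; congr (_ * _).
  rewrite (gaussian_bridge_symmetry a0 b0 (mphi 1%R) (phi0 1%R)).
  apply: eq_integral => u _; apply: eq_integral => v _.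
  by rewrite /f /phi/= mul1r mulN1r.
have posE : (fun w => (b * U w - a * V w)%:E)^\+ = (fun w => (ppart (1 * (b * U w - a * V w)))%:E).
  by apply/funext => w; rewrite funeposE mul1r /ppart -EFin_max.
have negE : (fun w => (b * U w - a * V w)%:E)^\- = (fun w => (ppart (-1 * (b * U w - a * V w)))%:E).
  by apply/funext => w; rewrite funenegE mulN1r /ppart -EFin_max.
have fin : \int[P]_(w in D) (ppart (1 * (b * U w - a * V w)))%:E \is a fin_num.
  have := integrable_fin_num mD (integrable_funepos mD (integrableS measurableT mD (@subsetT _ _) iZ)).
  by rewrite (_ : (EFin \o _)^\+ = (fun w => (ppart (1 * (b * U w - a * V w)))%:E)).
by rewrite -/D integralE posE negE sym subee// -sym.
Qed.

End conditioned_gaussian_pair.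

(** * The enlarged past of the bridge process *)

Section independence.
Context d (Omega : measurableType d) (R : realType) (P : probability Omega R).
Implicit Types (G : set (set Omega)) (A E : set Omega) (Z : Omega -> R).

(** The measurable sets over which [Z] integrates to 0 form a Dynkin class, stability under
    complements coming from [G setT]; it then suffices to check a pi-system. *)
Lemma Rintegral0_sigma_algebra G Z : (forall A, G A -> measurable A) ->
  setI_closed G -> G setT -> P.-integrable setT (EFin \o Z) ->
  (forall A, G A -> (\int[P]_(w in A) (Z w)%:E)%E = 0%E) ->
  forall A, <<s G >> A -> measurable A /\ (\int[P]_(w in A) (Z w)%:E)%E = 0%E.
Proof.
move=> mG GI GT iZ Z0; rewrite -setI_closed_g_dynkin_g_sigma_algebra//.
have iZS A : measurable A -> P.-integrable A (EFin \o Z).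
  by move=> mA; exact: integrableS iZ.
apply: smallest_sub; last by move=> A GA; split; [exact: mG|exact: Z0].
split => [|A [mA A0]|F tF FP].
- by split; [exact: measurableT|exact: Z0].
- split; first exact: measurableC.
  have ZT := Z0 _ GT; rewrite -(setvU A) in ZT.
  have mC : measurable (~` A) by exact: measurableC.
  rewrite integral_setU//= in ZT; last 2 first.
  + by apply: measurable_funTS; case/integrableP: iZ.
  + by apply/disj_setPS => x [].
  by rewrite A0 adde0 in ZT.
- have mF n : measurable (F n) by have [] := FP n.
  split; first exact: bigcupT_measurable.
  rewrite integral_bigcup//; last first.
    by apply: iZS; exact: bigcupT_measurable.
  by rewrite eseries0// => n _ _; have [] := FP n.
Qed.

(** Under P restricted to [E], the law of [Z] is its law under P scaled by [P E]. Both sides are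
    integrals against the same [kappa], seen through [ge0_integral_density] with density the
    indicator of [E] or the constant [k]; positive and negative parts are treated apart. *)
Lemma integral_independent E Z : measurable E -> P.-integrable setT (EFin \o Z) ->
  (forall B : set R, measurable B -> P (E `&` Z @^-1` B) = (P E * P (Z @^-1` B))%E) ->
  (\int[P]_(w in E) (Z w)%:E = P E * \int[P]_w (Z w)%:E)%E.
Proof.
move=> mE iZ EZ; have mZ : measurable_fun setT Z by case/integrableP: iZ => /measurable_EFinP.
pose k := fine (P E); have kE : k%:E = P E by rewrite fineK// fin_num_measure.
have k0 : 0 <= k by rewrite fine_ge0.
pose kappa := measure_function_pushforward__canonical__measure_function_Measure
  (mrestr P mE) (mZ : measurable_fun setT (Z : Omega -> measurableTypeR R)).
have kappaE (B : set (measurableTypeR R)) : measurable B -> kappa B = P (E `&` Z @^-1` B).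
  by move=> mB; rewrite setIC.
have mpre (B : set (measurableTypeR R)) : measurable B -> measurable (Z @^-1` B).
  by move=> mB; rewrite -[X in measurable X]setTI; exact: (mZ measurableT).
have key (f : measurableTypeR R -> \bar R) : measurable_fun setT f -> (forall x, (0 <= f x)%E) ->
    (\int[P]_(w in E) f (Z w) = P E * \int[P]_w f (Z w))%E.
  move=> mf f0; transitivity (\int[kappa]_x f x)%E.
    rewrite (@ge0_integral_density _ _ _ _ _ P kappa Z (\1_E))//.
      rewrite [LHS]integral_mkcond; apply: eq_integral => w _.
      by rewrite patchE indicE /=; case: ifP => _; rewrite ?mule1 ?mule0.
    move=> B mB; rewrite kappaE// -(setIT (_ `&` _)) -integral_indic//; last first.
      by apply: measurableI => //; exact: mpre.
    apply: eq_integral => w _; rewrite !indicE in_setI.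
    by case: (_ \in E); rewrite ?mulr1 ?mulr0.
  rewrite (@ge0_integral_density _ _ _ _ _ P kappa Z (cst k))//.
    rewrite [LHS]/= ge0_integralZr// -?kE ?lee_fin//; first by rewrite muleC.
    exact: measurableT_comp.
  move=> B mB; rewrite kappaE// EZ// -kE -(setIT (_ @^-1` _)) -integral_indic//; last exact: mpre.
  rewrite -ge0_integralZl//.
    by apply: eq_integral => w _; rewrite /= -EFinM mulrC.
  by apply/measurable_EFinP; apply: measurable_indic; exact: mpre.
rewrite [LHS]integralE [in RHS]integralE.
have mp (s : R) : measurable_fun setT (fun x : measurableTypeR R => (ppart (s * x))%:E).
  apply/measurable_EFinP; apply: measurableT_comp (continuous_measurable_fun (@continuous_ppart R)) _.
  exact: measurable_funM.
have pp (s : R) := key _ (mp s) (fun x => ppart_ge0 _).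
have posE : (fun w => (Z w)%:E)^\+%E = (fun w => (ppart (1 * Z w))%:E).
  by apply/funext => w; rewrite funeposE mul1r /ppart -EFin_max.
have negE : (fun w => (Z w)%:E)^\-%E = (fun w => (ppart (-1 * Z w))%:E).
  by apply/funext => w; rewrite funenegE mulN1r /ppart -EFin_max.
have fin_neg : (\int[P]_w (ppart (-1 * Z w))%:E)%E \is a fin_num.
  have := integrable_fin_num measurableT (integrable_funeneg measurableT iZ).
  by rewrite negE.
rewrite posE negE !pp -kE; move: (\int[P]_w _)%E (\int[P]_w _)%E fin_neg => x y fy.
by rewrite muleBr// fin_num_adde_defl// fin_numN.
Qed.

End independence.

Section sigma_process_lemmas.
Context d (Omega : measurableType d) (R : realType).
Implicit Types (Y : R -> Omega -> R) (I J : set R) (A B : set Omega).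

Lemma sigma_processI I Y A B :
  sigma_process I Y A -> sigma_process I Y B -> sigma_process I Y (A `&` B).
Proof. exact: (@measurableI _ (g_sigma_algebraType _)). Qed.

Lemma sigma_processT I Y : sigma_process I Y setT.
Proof. exact: (@measurableT _ (g_sigma_algebraType _)). Qed.

Lemma sigma_processS I J Y : I `<=` J -> sigma_process I Y `<=` sigma_process J Y.
Proof.
move=> IJ; apply: sub_sigma_algebra2 => A [u Iu YA].
by exists u => //; exact: IJ.
Qed.

(** Omega with [sigma_process I Y] as its measurable structure, so that measurability with respect
    to this sigma-field is an ordinary [measurable_fun]. *)
Definition process_algebra I Y := g_sigma_algebraType
  (\bigcup_(u in I) preimage_set_system setT (Y u) (@measurable _ R)).

Lemma process_measurable I Y u : I u ->
  measurable_fun setT (Y u : process_algebra I Y -> R).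
Proof.
by move=> Iu _ B mB; apply: sub_sigma_algebra; exists u => //; exists B.
Qed.

Lemma sigma_process_preimage I Y (Z : Omega -> R) (B : set R) :
  measurable_fun setT (Z : process_algebra I Y -> R) -> measurable B ->
  sigma_process I Y (Z @^-1` B).
Proof. by move=> mZ mB; have := mZ measurableT B mB; rewrite setTI. Qed.

Lemma sigma_process_measurable I Y A : (forall u, I u -> measurable_fun setT (Y u)) ->
  sigma_process I Y A -> measurable A.
Proof.
move=> mY; apply: smallest_sub => [|B [u Iu [C mC <-]]]; last exact: mY.
by split => [|B mB|F mF]; [exact: measurable0|rewrite setTD; exact: measurableC|exact: bigcupT_measurable].
Qed.

End sigma_process_lemmas.

(** * Independence of the future from the enlarged past *)

Section enlarged_filtration.
Context d (Omega : measurableType d) (R : realType) (P : probability Omega R).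
Variables (T lambda : R) (W X : R -> {RV P >-> R})
  (nu : {measure set (measurableTypeR R) -> \bar R}).
Hypotheses (T0 : 0 < T) (bmW : brownian_motion T W) (fvX : fv_levy_process T X lambda nu)
  (WX : indep_processes T W X)
  (big : nu.-integrable [set x | 1 <= `|x|] (fun x => x%:E)).

Local Notation FW := (sigma_process (Omega := Omega) (R := R)^~ (fun u => W u : Omega -> R)).
Local Notation FX := (sigma_process (Omega := Omega) (R := R)^~ (fun u => X u : Omega -> R)).

Lemma bm_increment_norm s t : 0 <= s -> s < t -> t <= T ->
  (\int[P]_w `|W t w - W s w|%:E <= (Num.sqrt (2 * (t - s)))%:E)%E.
Proof.
move=> s0 st tT; have ts0 : 0 < t - s by rewrite subr_gt0.
apply: le_trans (normal_abs_moment ts0).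
rewrite (_ : (\int[normal_prob 0 (Num.sqrt (t - s))]_x `|x|%:E =
  \int[P]_w `|W t w - W s w|%:E)%E)//.
have mD : measurable_fun setT (fun w => W t w - W s w : measurableTypeR R) by exact: measurable_funB.
rewrite (@ge0_integral_density _ _ _ _ _ P (normal_prob 0 (Num.sqrt (t - s)))
  (fun w => W t w - W s w) (cst 1))//.
- by apply: eq_integral => w _; rewrite mule1.
- move=> B mB; transitivity (pushforward P (W t \- W s) B).
    exact/esym/(bm_gauss bmW s0 st tT mB).
  rewrite /pushforward -(setIT (_ @^-1` _)) -integral_indic//.
    by apply: eq_integral => w _; rewrite mulr1.
  by rewrite -[X in measurable X]setTI; exact: mD.
- by apply/measurable_EFinP; exact: normr_measurable.
Qed.

Lemma bm_increment_integrable s t : 0 <= s -> s <= t -> t <= T ->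
  P.-integrable setT (EFin \o (W t \- W s)).
Proof.
move=> s0; rewrite le_eqVlt => /predU1P[<- _|st tT].
  rewrite (_ : _ \o _ = cst 0%E); first exact: integrable0.
  by apply/funext => w; rewrite /= subrr.
apply/integrableP; split; first by apply/measurable_EFinP; exact: measurable_funB.
by apply: le_lt_trans (bm_increment_norm s0 st tT) _; rewrite ltry.
Qed.

Lemma bm_integrable t : 0 <= t <= T -> P.-integrable setT (EFin \o W t).
Proof.
move=> /andP[t0 tT]; have := bm_increment_integrable (lexx 0) t0 tT.
apply: eq_integrable => // w _; by rewrite /= (bm_start bmW) subr0.
Qed.

Section fixed_time.
Variable s : R.
Hypothesis sT : 0 <= s < T.

(* A pi-system generating a sigma-field larger than that of [eta] up to time [s],
   because the bridge involves [W T]; it stays independent of the bridge from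
   [s] to [T] and of the increments of [X] after [s]. *)
Definition past_sets : set (set Omega) := [set A | exists F0 A2 (B : set R),
  [/\ FW `[0, s]%classic F0, FX `[0, s]%classic A2, measurable B &
      A = F0 `&` A2 `&` (W T \- W s) @^-1` B]].

Let s0 : 0 <= s. Proof. by case/andP: sT. Qed.
Let sT' : s < T. Proof. by case/andP: sT. Qed.

Lemma past_setsI : setI_closed past_sets.
Proof.
move=> _ _ [F1 [A1 [B1 [F1s A1s mB1 ->]]]] [F2 [A2 [B2 [F2s A2s mB2 ->]]]].
exists (F1 `&` F2), (A1 `&` A2), (B1 `&` B2); split.
- exact: sigma_processI.
- exact: sigma_processI.
- exact: measurableI.
- by rewrite preimage_setI setIACA; congr (_ `&` _); rewrite setIACA.
Qed.

Lemma past_setsT : past_sets setT.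
Proof.
exists setT, setT, setT; split; [exact: sigma_processT|exact: sigma_processT|exact: measurableT|].
by rewrite preimage_setT !setIT.
Qed.

Let mFW (I : set R) A : FW I A -> measurable A.
Proof. by apply: sigma_process_measurable => u _; exact: measurable_funP. Qed.

Let mFX (I : set R) A : FX I A -> measurable A.
Proof. by apply: sigma_process_measurable => u _; exact: measurable_funP. Qed.

Let mWB t u (B : set R) : measurable B -> measurable ((W t \- W u) @^-1` B).
Proof.
by move=> mB; rewrite -[X in measurable X]setTI; apply: measurable_funB.
Qed.

Lemma past_sets_measurable A : past_sets A -> measurable A.
Proof.
move=> [F0 [A2 [B [F0s A2s mB ->]]]]; apply: measurableI; last exact: mWB.
by apply: measurableI; [exact: mFW F0s|exact: mFX A2s].
Qed.

Let increment_preimage (Y : R -> {RV P >-> R}) t u (B : set R) : measurable B ->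
  g_sigma_algebra_preimage (Y t \- Y u) ((Y t \- Y u) @^-1` B).
Proof. by move=> mB; exists B => //; rewrite setTI. Qed.

Let increment_past (Y : R -> {RV P >-> R}) (t u v : R) (B : set R) : 0 <= u -> u <= t -> t <= v ->
  measurable B -> sigma_process `[0, v] (fun u => Y u : Omega -> R) ((Y t \- Y u) @^-1` B).
Proof.
move=> u0 ut tv mB; apply: sigma_process_preimage => //.
apply: measurable_funB; apply: (@process_measurable _ _ _ _ (fun u => Y u : Omega -> R)).
  by rewrite /= in_itv/= (le_trans u0 ut).
by rewrite /= in_itv/= u0 (le_trans ut).
Qed.

Let upto (Y : R -> Omega -> R) (t u : R) : t <= u -> sigma_process `[0, t] Y `<=` sigma_process `[0, u] Y.
Proof. by move=> tu; apply: sigma_processS; apply: subset_itvl; rewrite bnd_simp. Qed.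

Section intermediate.
Variable r : R.
Hypothesis srT : s < r < T.
Let sr : s < r. Proof. by case/andP: srT. Qed.
Let rT : r < T. Proof. by case/andP: srT. Qed.
Let r0 : 0 <= r. Proof. by rewrite (le_trans s0)// ltW. Qed.

Let dW (t u : R) : Omega -> R := W t \- W u.

(** The event on X is split off first, all the events on W being known at time T. Then W_T - W_r is
    independent of the past at r, which contains the event on W_r - W_s, and W_r - W_s is
    independent of the past at s. *)
Let bridge_law F0 A2 (A B : set R) : FW `[0, s]%classic F0 -> FX `[0, s]%classic A2 ->
  measurable A -> measurable B ->
  (P ((F0 `&` A2) `&` (dW r s @^-1` A `&` dW T r @^-1` B)) =
  P (F0 `&` A2) * (normal_prob 0 (Num.sqrt (r - s)) A * normal_prob 0 (Num.sqrt (T - r)) B))%E.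
Proof.
move=> F0s A2s mA mB.
have F0T := upto (ltW sT') F0s; have A2T := upto (ltW sT') A2s.
have sA : FW `[0, r]%classic (dW r s @^-1` A) by apply: increment_past => //; exact: ltW.
have UA : FW `[0, r]%classic (F0 `&` dW r s @^-1` A).
  by apply: sigma_processI => //; apply: (upto (ltW sr) F0s).
have VB : FW `[0, T]%classic (dW T r @^-1` B) by apply: increment_past => //; exact: ltW.
rewrite setIACA [A2 `&` _]setIC setIA WX//; last first.
  by apply: sigma_processI => //; exact: (upto (ltW rT) UA).
rewrite (bm_indep bmW r0 (ltW rT) (lexx T) UA (@increment_preimage W T r B mB)).
rewrite (bm_indep bmW s0 (ltW sr) (ltW rT) F0s (@increment_preimage W r s A mA)).
rewrite WX//.
have -> : P (dW r s @^-1` A) = normal_prob 0 (Num.sqrt (r - s)) A.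
  exact: (bm_gauss bmW s0 sr (ltW rT) mA).
have -> : P (dW T r @^-1` B) = normal_prob 0 (Num.sqrt (T - r)) B.
  exact: (bm_gauss bmW r0 rT (lexx T) mB).
by rewrite -!muleA; congr (_ * _)%E; rewrite muleA muleC.
Qed.

(** The third factor of a past set is an event on W_T - W_s, the sum of the pair (W_r - W_s, W_T -
    W_r), as [gaussian_bridge_centered] permits; the other two factors form its event [E]. *)
Lemma past_bridge A : <<s past_sets >> A -> measurable A /\
  (\int[P]_(w in A) ((T - r) * (W r w - W s w) - (r - s) * (W T w - W r w))%:E)%E = 0%E.
Proof.
have iU : P.-integrable setT (EFin \o (dW r s)).
  by apply: bm_increment_integrable => //; exact: ltW.
have iV : P.-integrable setT (EFin \o (dW T r)).
  by apply: bm_increment_integrable => //; exact: ltW.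
apply: (Rintegral0_sigma_algebra (Z := fun w => (T - r) * (W r w - W s w) - (r - s) * (W T w - W r w))).
- exact: past_sets_measurable.
- exact: past_setsI.
- exact: past_setsT.
- apply: (eq_integrable measurableT ((fun w => (T - r)%:E * (dW r s w)%:E) \- (fun w => (r - s)%:E * (dW T r w)%:E))%E) => //.
  by apply: integrableB => //; exact: integrableZl.
- move=> _ [F0 [A2 [B [F0s A2s mB ->]]]].
  have mE : measurable (F0 `&` A2) by apply: measurableI; [exact: mFW F0s|exact: mFX A2s].
  rewrite (_ : (W T \- W s) @^-1` B = [set w | B (dW r s w + dW T r w)]); last first.
    by apply/seteqP; split => w /=; rewrite (_ : dW r s w + dW T r w = W T w - W s w)//; rewrite /dW/=; ring.
  have mU : measurable_fun setT (dW r s) by exact: measurable_funB.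
  have mV : measurable_fun setT (dW T r) by exact: measurable_funB.
  apply: (gaussian_bridge_centered (a := r - s) (b := T - r) (U := dW r s) (V := dW T r)) => //.
  + by rewrite subr_gt0.
  + by rewrite subr_gt0.
  + by move=> A' B' mA' mB'; exact: bridge_law.
Qed.

End intermediate.

(** The increment of W in a past set reaches time T, but W is independent of X over all of [0, T].
    Grouping the events on W leaves the past of X and the increment X_r - X_s, independent by the
    Levy property. *)
Lemma past_levy r A : s <= r <= T -> <<s past_sets >> A -> measurable A /\
  (\int[P]_(w in A) (X r w - X s w - mean_rate lambda nu * (r - s))%:E)%E = 0%E.
Proof.
move=> /andP[sr rT]; have r0 : 0 <= r by rewrite (le_trans s0).
pose m := mean_rate lambda nu * (r - s); pose Z w := X r w - X s w.
have r0T : 0 <= r <= T by rewrite r0.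
have s0T : 0 <= s <= T by rewrite s0 ltW.
have iXr := levy_integrable fvX big r0T.
have iXs := levy_integrable fvX big s0T.
have iZ : P.-integrable setT (EFin \o Z) by exact: (integrableB measurableT iXr iXs).
have im : P.-integrable setT (EFin \o (cst m : Omega -> R)) by exact: finite_measure_integrable_cst.
have EZ : (\int[P]_w (Z w)%:E = m%:E)%E.
  rewrite integralB_EFin// !(levy_expectation fvX big)//.
  by rewrite -EFinB /m mulrBr.
apply: (Rintegral0_sigma_algebra (Z := fun w => Z w - m)).
- exact: past_sets_measurable.
- exact: past_setsI.
- exact: past_setsT.
- exact: (integrableB measurableT iZ im).
- move=> A' pA'; have mA' := past_sets_measurable pA'.
  rewrite integralB_EFin//; [|exact: integrableS iZ|exact: integrableS im].
  rewrite integral_cst//= (_ : (\int[P]_(w in A') (Z w)%:E)%E = (P A' * m%:E)%E).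
    by rewrite muleC subee// fin_numM// fin_num_measure.
  rewrite -EZ; apply: integral_independent => // C mC.
  case: pA' mA' => F0 [A2 [B [F0s A2s mB ->]]] mA'.
  have sC : FX `[0, T]%classic (Z @^-1` C).
    exact: (upto rT (@increment_past X r s r C s0 sr (lexx r) mC)).
  have F0T := upto (ltW sT') F0s; have A2T := upto (ltW sT') A2s.
  have WB : FW `[0, T]%classic (F0 `&` (W T \- W s) @^-1` B).
    by apply: sigma_processI => //; apply: increment_past => //; exact: ltW.
  rewrite (setIAC F0 A2) -setIA (WX WB (sigma_processI A2T sC)) (WX WB A2T).
  have -> : P (A2 `&` Z @^-1` C) = (P A2 * P (Z @^-1` C))%E.
    exact: (levy_indep (fvl_levy fvX) s0 sr rT A2s (@increment_preimage X r s C mC)).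
  by rewrite muleA.
Qed.


End fixed_time.
End enlarged_filtration.

(** * Means over events of the enlarged past *)

Section past_moments.
Context d (Omega : measurableType d) (R : realType) (P : probability Omega R).
Variables (T lambda : R) (W X : R -> {RV P >-> R})
  (nu : {measure set (measurableTypeR R) -> \bar R}).
Hypotheses (T0 : 0 < T) (bmW : brownian_motion T W) (fvX : fv_levy_process T X lambda nu)
  (WX : indep_processes T W X)
  (big : nu.-integrable [set x | 1 <= `|x|] (fun x => x%:E)).
Variable s : R.
Hypothesis sT : 0 <= s < T.

Let s0 : 0 <= s. Proof. by case/andP: sT. Qed.
Let sT' : s < T. Proof. by case/andP: sT. Qed.

Local Notation past := (past_sets T W X s).

Definition past_type := g_sigma_algebraType past.

Let past_mem_W (u : R) (B : set R) : 0 <= u <= s -> measurable B -> past (W u @^-1` B).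
Proof.
move=> us mB; exists (W u @^-1` B), setT, setT; split => //.
- apply: sigma_process_preimage => //.
  by apply: (@process_measurable _ _ _ _ (fun u => W u : Omega -> R)); rewrite /= in_itv.
- exact: sigma_processT.
- by rewrite preimage_setT !setIT.
Qed.

Let past_mem_X (u : R) (B : set R) : 0 <= u <= s -> measurable B -> past (X u @^-1` B).
Proof.
move=> us mB; exists setT, (X u @^-1` B), setT; split => //.
- exact: sigma_processT.
- apply: sigma_process_preimage => //.
  by apply: (@process_measurable _ _ _ _ (fun u => X u : Omega -> R)); rewrite /= in_itv.
- by rewrite preimage_setT setTI !setIT.
Qed.

Let past_W u : 0 <= u <= s -> measurable_fun setT (W u : past_type -> R).
Proof. by move=> us _ B mB; rewrite setTI; apply: sub_sigma_algebra; exact: past_mem_W. Qed.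

Let past_X u : 0 <= u <= s -> measurable_fun setT (X u : past_type -> R).
Proof. by move=> us _ B mB; rewrite setTI; apply: sub_sigma_algebra; exact: past_mem_X. Qed.

(** W_T = (W_T - W_s) + W_s: the third factor of [past_sets] supplies the first term. *)
Let past_WT : measurable_fun setT (W T : past_type -> R).
Proof.
rewrite (_ : (W T : past_type -> R) = (fun w => (W T \- W s) w + W s w)); last first.
  by apply/funext => w /=; rewrite subrK.
apply: measurable_funD; last by apply: past_W; rewrite s0 lexx.
move=> _ B mB; rewrite setTI; apply: sub_sigma_algebra.
exists setT, setT, B; split => //; try exact: sigma_processT.
by rewrite !setTI.
Qed.

Lemma natural_filtration_past : natural_filtration (eta_bridge T W X) s `<=` <<s past >>.
Proof.
apply: smallest_sub; first exact: smallest_sigma_algebra.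
move=> A [u /= us [B mB <-]].
have us' : 0 <= u <= s by rewrite in_itv/= in us.
have : measurable_fun setT (eta_bridge T W X u : past_type -> R).
  apply: measurable_funD; last by apply: measurable_funM => //; exact: past_X.
  by apply: measurable_funB; [exact: past_W|exact: measurable_funM].
by move=> /(_ measurableT B mB).
Qed.

Definition bridge t w : R := W t w - t / T * W T w.

Lemma bridge_integrable t : 0 <= t <= T -> P.-integrable setT (EFin \o bridge t).
Proof.
move=> tT; apply: (eq_integrable measurableT ((EFin \o W t) \- (fun w => (t / T)%:E * (W T w)%:E))%E) => //.
have TT : 0 <= T <= T by rewrite lexx andbT ltW.
have iWT := bm_integrable bmW TT.
by apply: integrableB => //; [exact: (bm_integrable bmW)|exact: integrableZl].
Qed.

Variable A : set Omega.
Hypothesis pA : <<s past >> A.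

Let mA : measurable A.
Proof.
have sTT : s <= T <= T by rewrite lexx ltW.
by have [] := past_levy fvX WX big sT sTT pA.
Qed.

Lemma bridge_past_mean r : s <= r <= T ->
  \int[P]_(w in A) bridge r w = (T - r) / (T - s) * \int[P]_(w in A) bridge s w.
Proof.
move=> /andP[]; rewrite le_eqVlt => /predU1P[<- _|sr].
  by rewrite divff ?mul1r// subr_eq0 gt_eqF.
(* The Gaussian argument needs two increments of positive length, so r = s and r = T are set apart;
   at r = T the bridge is 0. *)
rewrite le_eqVlt => /predU1P[->|rT].
  rewrite subrr !mul0r /Rintegral (eq_integral (cst 0%E)) ?integral0// => w _.
  by rewrite /bridge divff ?gt_eqF// mul1r subrr.
have srT : s < r < T by rewrite sr.
have sTn : T - s != 0 by rewrite subr_eq0 gt_eqF.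
have Tn : T != 0 by rewrite gt_eqF.
have [_] := past_bridge bmW WX sT srT pA.
have iA t : 0 <= t <= T -> P.-integrable A (EFin \o bridge t).
  by move=> tT; apply: integrableS (bridge_integrable tT).
have sT0 : 0 <= s <= T by rewrite s0 ltW.
have rT0 : 0 <= r <= T by rewrite (le_trans s0) ltW.
(* The coefficients of W_s, W_r and W_T agree: (T - r)(W_r - W_s) - (r - s)(W_T - W_r) = (T - s) b_r
   - (T - r) b_s. *)
rewrite (eq_integral (fun w => ((T - s) * bridge r w - (T - r) * bridge s w)%:E)); last first.
  by move=> w _; rewrite /bridge; congr EFin; field.
move/(congr1 fine); rewrite -/(Rintegral _ _ _).
rewrite RintegralB//; last 2 first.
- by apply: (eq_integrable mA (fun w => (T - s)%:E * (bridge r w)%:E)%E) => //; apply: integrableZl => //; exact: iA.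
- by apply: (eq_integrable mA (fun w => (T - r)%:E * (bridge s w)%:E)%E) => //; apply: integrableZl => //; exact: iA.
rewrite !RintegralZl//; [|exact: iA|exact: iA].
move=> /eqP; rewrite subr_eq0 => /eqP H.
by rewrite mulrAC -H mulrC mulKf.
Qed.

Lemma levy_past_mean r : s <= r <= T ->
  \int[P]_(w in A) X r w =
  \int[P]_(w in A) X s w + mean_rate lambda nu * (r - s) * fine (P A).
Proof.
move=> srT; have [_] := past_levy fvX WX big sT srT pA.
case/andP: srT => sr rT.
have sT0 : 0 <= s <= T by rewrite s0 ltW.
have rT0 : 0 <= r <= T by rewrite (le_trans s0).
have iA t : 0 <= t <= T -> P.-integrable A (EFin \o X t).
  by move=> tT; apply: integrableS (levy_integrable fvX big tT).
have ic : P.-integrable A (EFin \o cst (mean_rate lambda nu * (r - s))).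
  exact: finite_measure_integrable_cst.
move/(congr1 fine); rewrite -/(Rintegral _ _ _) RintegralB//; last first.
  by apply: (eq_integrable mA ((EFin \o X r) \- (EFin \o X s))%E) => //; apply: integrableB => //; exact: iA.
rewrite RintegralB//; [|exact: iA|exact: iA].
rewrite Rintegral_cst// => /eqP; rewrite subr_eq0 subr_eq => /eqP ->.
by rewrite addrC.
Qed.

End past_moments.

(** * The drift of the bridge process *)

(** Squaring first makes the base of the real power nonnegative, where the power -1 is the inverse;
    at 0 both sides are 0 since [0^-1 = 0]. *)
Lemma measurable_inv (R : realType) : measurable_fun setT (fun x : R => x^-1).
Proof.
rewrite (_ : (fun x => _) = (fun x : R => x * (x ^+ 2) `^ (-1))).
  apply: measurable_funM => //.
  by apply: (measurableT_comp (measurable_powR _)); exact: measurable_funX.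
apply/funext => x; rewrite powR_inv1 ?sqr_ge0//.
have [->|x0] := eqVneq x 0; first by rewrite invr0 mul0r.
by rewrite expr2 invfM mulrA divff// mul1r.
Qed.

(** * Adaptedness of the candidate martingale *)

Section adapted.
Context d (S : measurableType d) (R : realType).
Variables (T lambda : R) (nu : {measure set (measurableTypeR R) -> \bar R})
  (Z : R -> S -> R) (t : R).
Hypotheses (T0 : 0 < T) (tT : 0 <= t <= T)
  (mZ : forall u, 0 <= u <= t -> measurable_fun setT (Z u))
  (cZ : forall w, cadlag T (Z^~ w)).

Let Y u : S -> R := Z (clamp t u).

Let t0 : 0 <= t. Proof. by case/andP: tT. Qed.

Let mY u : measurable_fun setT (Y u).
Proof. by apply: mZ; exact: clamp_itv. Qed.

Let cY w : rcll (Y^~ w).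
Proof. exact: (rcll_clamp (cZ w) tT). Qed.

Let drift_rate (e : R -> S -> R) (w : S) (s : R) : R :=
  (fv_drift lambda nu * s + T * rsum [set u | 0 < u <= s] (fun u => jump (e^~ w) u / u) - e s w) / (T - s).

Let drift_rate_clamp w s : 0 <= s <= t -> drift_rate Z w s = drift_rate Y w s.
Proof.
move=> /andP[s0 st]; rewrite /drift_rate; congr ((_ + _ * _ - _) / _); last first.
  by rewrite /Y clamp_id// s0.
rewrite /rsum; congr (fine (_ - _)); apply: eq_esum => u /= /andP[u0 us].
  by rewrite /funrpos (@jump_clamp _ (Z^~ w))// u0 (le_trans us).
by rewrite /funrneg (@jump_clamp _ (Z^~ w))// u0 (le_trans us).
Qed.

Lemma measurable_drift_rate : measurable_fun setT (fun p : S * R => drift_rate Y p.1 p.2).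
Proof.
have m2 := @measurable_snd _ _ S (measurableTypeR R).
apply: measurable_funM; last first.
  apply: (measurableT_comp (@measurable_inv R)).
  by apply: measurable_funB => //; exact: m2.
apply: measurable_funB; last by apply: measurable_rcont => // w; exact: (cY w).1.
apply: measurable_funD; first by apply: measurable_funM => //; exact: m2.
apply: measurable_funM => //.
apply: measurable_rsum_jump => //.
- exact: measurable_inv.
- by move=> x x0; rewrite invr_ge0 ltW.
- by move=> x x0; apply: inv_continuous; rewrite gt_eqF.
Qed.

(** [S] will be Omega with its own sigma-field or with the one generated by the process up to [t],
    which yields measurability and adaptedness respectively. On [0, t] the integrand only sees the
    process frozen at [t], for which it is jointly measurable. *)
Lemma measurable_Mtilde : measurable_fun setT (Mtilde T lambda nu Z t).
Proof.
apply: measurable_funB => //.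
apply: measurable_funB; first by apply: mZ; rewrite t0 lexx.
(* Positive and negative parts are separated because Tonelli's theorem gives measurability without
   integrability, which is not known for every outcome. *)
rewrite (_ : (fun w => _) = (fun w => fine (
   \int[lebesgue_measure]_s (ppart (drift_rate Y w s) * \1_(`[0, t]%classic) s)%:E -
   \int[lebesgue_measure]_s (ppart (- drift_rate Y w s) * \1_(`[0, t]%classic) s)%:E)%E)); last first.
  apply/funext => w; rewrite /Rintegral; congr fine.
  rewrite [LHS]integralE; congr (_ - _)%E; rewrite [LHS]integral_mkcond; apply: eq_integral => s _;
    rewrite patchE indicE mem_setE.
  - case: ifPn => st; last by rewrite mulr0.
    by rewrite mulr1 funeposE -EFin_max -drift_rate_clamp.
  - case: ifPn => st; last by rewrite mulr0.
    by rewrite mulr1 funenegE -EFin_max -drift_rate_clamp.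
have mpart (k : R) : measurable_fun setT (fun w : S =>
    (\int[lebesgue_measure]_s (ppart (k * drift_rate Y w s) * \1_(`[0, t]%classic) s)%:E)%E).
  apply: (@measurable_fun_fubini_tonelli_F _ _ S (measurableTypeR R) R lebesgue_measure
    (fun p => (ppart (k * drift_rate Y p.1 p.2) * \1_(`[0, t]%classic) p.2)%:E)).
    apply/measurable_EFinP; apply: measurable_funM.
      apply: measurableT_comp (continuous_measurable_fun (@continuous_ppart R)) _.
      by apply: measurable_funM => //; exact: measurable_drift_rate.
    by apply: measurableT_comp; [exact: measurable_indic|exact: measurable_snd].
  by move=> p; rewrite lee_fin mulr_ge0 ?ppart_ge0.
apply: measurableT_comp => //; apply: emeasurable_funB.
  by have := mpart 1; under eq_fun do under eq_integral do rewrite mul1r.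
by have := mpart (-1); under eq_fun do under eq_integral do rewrite mulN1r.
Qed.

End adapted.

(** * The singularity at the terminal time *)

Section inverse_sqrt.
Local Open Scope ereal_scope.
Context {R : realType}.
Notation mu := (@lebesgue_measure R).
Variable T : R.
Hypothesis T0 : (0 < T)%R.

Let f (x : R) : R := (Num.sqrt x)^-1.

Let mf : measurable_fun setT (EFin \o f).
Proof.
apply/measurable_EFinP; apply: measurableT_comp (@measurable_inv R) _.
exact: (continuous_measurable_fun (@sqrt_continuous R)).
Qed.

Let f0 x : 0 <= (f x)%:E. Proof. by rewrite lee_fin invr_ge0 sqrtr_ge0. Qed.

Let integral_inv_sqrt_away (a : R) : (0 < a < T)%R ->
  \int[mu]_(x in `[a, T]) (f x)%:E <= (2 * Num.sqrt T)%:E.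
Proof.
move=> /andP[a0 aT].
have dF (x : R) : (0 < x)%R -> is_derive x 1%R (fun x : R => 2 * Num.sqrt x)%R (f x).
  move=> x0; have H := is_derive1_sqrt x0.
  apply: is_derive_eq; rewrite /f /GRing.scale/=.
  by field; rewrite gt_eqF// sqrtr_gt0.
have cF (x : R) : (0 < x)%R -> {for x, continuous (fun x : R => 2 * Num.sqrt x)%R}.
  move=> x0; apply: cvgM; first exact: cvg_cst.
  exact: sqrt_continuous.
rewrite (@continuous_FTC2 _ f (fun x : R => 2 * Num.sqrt x)%R)//.
- by rewrite -EFinB lee_fin gerBl mulr_ge0// sqrtr_ge0.
- apply: continuous_in_subspaceT => x; rewrite inE/= in_itv/= => /andP[ax _].
  apply: continuousV; first by rewrite gt_eqF// sqrtr_gt0 (lt_le_trans a0).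
  exact: sqrt_continuous.
- split.
  + move=> x; rewrite in_itv/= => /andP[ax _].
    by have [] := dF x (lt_trans a0 ax).
  + by apply: cvg_at_right_filter; exact: cF.
  + by apply: cvg_at_left_filter; apply: cF.
- move=> x; rewrite in_itv/= => /andP[ax _].
  by rewrite derive1E; have [_ ->] := dF x (lt_trans a0 ax).
Qed.

Lemma integral_inv_sqrt : \int[mu]_(x in `]0%R, T]) (f x)%:E <= (2 * Num.sqrt T)%:E.
Proof.
(* [n.+2] rather than [n.+1] keeps [a n < T], so that the fundamental theorem applies on each
   interval. *)
pose a (n : nat) : R := (T / n.+2%:R)%R.
have a0 n : (0 < a n)%R by rewrite divr_gt0.
have aT n : (a n < T)%R by rewrite ltr_pdivrMr// ltr_pMr// ltr1n.
have -> : `]0%R, T]%classic = \bigcup_n `[a n, T]%classic.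
  apply/seteqP; split => [x|x [n _]]; rewrite /= !in_itv/= => /andP[x0 xT].
    exists (Num.trunc (T / x)) => //=; rewrite in_itv/= xT andbT.
    rewrite /a ler_pdivrMr// mulrC -ler_pdivrMr// ltW// (lt_trans (truncnS_gt _))//.
    by rewrite ltr_nat.
  by rewrite xT (lt_le_trans (a0 n)).
have L : \int[mu]_(x in `[a n, T]) (f x)%:E @[n --> \oo] -->
    \int[mu]_(x in \bigcup_n `[a n, T]%classic) (f x)%:E.
  apply: ge0_nondecreasing_set_cvg_integral => [m n mn|n|n|n x _].
  - apply/subsetPset; apply: subset_itvr; rewrite bnd_simp.
    by rewrite ler_pM2l// lef_pV2 ?posrE// ler_nat !ltnS.
  - exact: measurable_itv.
  - exact: measurable_funTS.
  - exact: f0.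
rewrite -(cvg_lim _ L)//; apply: lime_le; first by apply/cvg_ex; eexists; exact: L.
by apply: nearW => n; apply: integral_inv_sqrt_away; rewrite a0 aT.
Qed.

Lemma integral_inv_sqrt_reflected :
  \int[mu]_(s in `[0%R, T]) ((Num.sqrt (T - s))^-1)%:E <= (2 * Num.sqrt T)%:E.
Proof.
apply: le_trans integral_inv_sqrt.
pose g (x : R) := (f x * \1_(`]0%R, T]%classic) x)%:E.
have mg : measurable_fun setT g.
  by apply/measurable_EFinP; apply: measurable_funM; [exact/measurable_EFinP|exact: measurable_indic].
have g0 x : 0 <= g x by rewrite lee_fin mulr_ge0// invr_ge0 sqrtr_ge0.
have -> : \int[mu]_(x in `]0%R, T]) (f x)%:E = \int[mu]_x g x.
  rewrite integral_mkcond; apply: eq_integral => x _.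
  by rewrite patchE /g indicE; case: ifP => _; rewrite ?mulr1 ?mulr0.
rewrite -(lebesgue_integral_reflect T mg g0) [leLHS]integral_mkcond.
apply: ge0_le_integral => //.
- by move=> x _; rewrite patchE; case: ifP => // _; exact: f0.
- apply/(measurable_restrictT _ _).1 => //; apply: measurable_funTS.
  by apply: (measurableT_comp mf); exact: measurable_funB.
- by apply: measurableT_comp => //; exact: measurable_funB.
move=> s _; rewrite patchE; case: ifPn => [|_]; last exact: g0.
(* At s = T the integrand is 0 because [0^-1 = 0]. *)
rewrite mem_setE in_itv/= => /andP[s0]; rewrite le_eqVlt => /predU1P[->|sT].
  by rewrite subrr sqrtr0 invr0 g0.
rewrite /g indicE mem_set ?mulr1//=.
by rewrite in_itv/= subr_gt0 sT gerBl.
Qed.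

End inverse_sqrt.

(** Valid without summability: [fine] sends infinite values to 0, and a positive factor keeps
    infinite values infinite. *)
Lemma rsumZ (R : realType) (D : set R) (c : R) (f : R -> R) : 0 < c ->
  rsum D (fun u => c * f u) = c * rsum D f.
Proof.
move=> c0; rewrite /rsum.
have partE (h : R -> R) : (forall u, 0 <= h u) ->
    (\esum_(u in D) (c * h u)%:E = c%:E * \esum_(u in D) (h u)%:E)%E.
  by move=> h0; rewrite -esumZl ?ltW// => u _; rewrite lee_fin.
have -> : (fun u => c * f u)^\+ = (fun u => c * f^\+ u).
  by apply/funext => u; rewrite /funrpos maxr_pMr ?mulr0 ?ltW.
have -> : (fun u => c * f u)^\- = (fun u => c * f^\- u).
  by apply/funext => u; rewrite /funrneg maxr_pMr ?mulr0 ?mulrN ?ltW.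
rewrite !partE; [|exact: funrneg_ge0|exact: funrpos_ge0].
have c0e : (0 < c%:E)%E by rewrite lte_fin.
move: (\esum_(u in D) _)%E (\esum_(u in D) _)%E => [x| |] [y| |];
  rewrite /= ?(gt0_muley c0e) ?(gt0_muleNy c0e) /= ?mulr0//.
by rewrite mulrBr.
Qed.

Section eta_paths.
Context d (Omega : measurableType d) (R : realType) (P : probability Omega R).
Variables (T lambda : R) (W X : R -> {RV P >-> R})
  (nu : {measure set (measurableTypeR R) -> \bar R}).
Hypotheses (T0 : 0 < T) (bmW : brownian_motion T W) (fvX : fv_levy_process T X lambda nu).

Local Notation eta := (eta_bridge T W X).

Let cW w : [/\ {in `]0, T[, continuous (fun t => W t w)},
  W t w @[t --> 0^'+] --> W 0 w & W t w @[t --> T^'-] --> W T w].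
Proof. exact/(continuous_within_itvP _ T0)/(bm_continuous bmW). Qed.

Lemma bm_right_continuous w t : 0 <= t < T -> W v w @[v --> t^'+] --> W t w.
Proof.
have [ci c0 _] := cW w; move=> /andP[]; rewrite le_eqVlt => /predU1P[<- //|t0 tT].
by apply: cvg_at_right_filter; apply: ci; rewrite in_itv/= t0.
Qed.

Lemma bm_left_continuous w t : 0 < t <= T -> W v w @[v --> t^'-] --> W t w.
Proof.
have [ci _ cT] := cW w; move=> /andP[t0]; rewrite le_eqVlt => /predU1P[-> //|tT].
by apply: cvg_at_left_filter; apply: ci; rewrite in_itv/= t0.
Qed.

Lemma cadlag_eta w : cadlag T (eta^~ w).
Proof.
have [Xr Xl] := levy_cadlag (fvl_levy fvX) w.
split => t tT; rewrite /eta_bridge.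
  apply: cvgD; last first.
    apply: cvgM; last exact: Xr.
    by apply: cvgM; [exact: cvg_within|exact: cvg_cst].
  apply: cvgB; first exact: bm_right_continuous.
  apply: cvgM; last exact: cvg_cst.
  by apply: cvgM; [exact: cvg_within|exact: cvg_cst].
apply: is_cvgD; last first.
  apply: is_cvgM; last exact: Xl.
  apply: is_cvgM; last exact: is_cvg_cst.
  by apply/cvg_ex; exists t; exact: cvg_within.
apply: is_cvgB.
  by apply/cvg_ex; exists (W t w); exact: bm_left_continuous.
apply: is_cvgM; last exact: is_cvg_cst.
apply: is_cvgM; last exact: is_cvg_cst.
by apply/cvg_ex; exists t; exact: cvg_within.
Qed.

Lemma jump_eta w u : 0 < u <= T -> jump (eta^~ w) u = T^-1 * u * jump (X^~ w) u.
Proof.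
move=> uT; have [_ Xl] := levy_cadlag (fvl_levy fvX) w.
rewrite -(left_cont_jumpD (f := fun v => W v w - v / T * W T w)).
- by congr (jump _ u); apply/funext => v; rewrite /eta_bridge [v / T]mulrC.
- apply: cvgB; first exact: bm_left_continuous.
  apply: cvgM; last exact: cvg_cst.
  by apply: cvgM; [exact: cvg_within|exact: cvg_cst].
- exact: Xl.
Qed.

Lemma rsum_jump_eta w s : 0 <= s <= T ->
  T * rsum [set u | 0 < u <= s] (fun u => jump (eta^~ w) u / u) =
  rsum [set u | 0 < u <= s] (jump (X^~ w)).
Proof.
move=> /andP[s0 sT].
have -> : rsum [set u | 0 < u <= s] (fun u => jump (eta^~ w) u / u) =
    rsum [set u | 0 < u <= s] (fun u => T^-1 * jump (X^~ w) u).
  have E u : 0 < u <= s -> jump (eta^~ w) u / u = T^-1 * jump (X^~ w) u.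
    move=> /andP[u0 us]; rewrite jump_eta ?u0 ?(le_trans us)//.
    by field; rewrite !gt_eqF.
  by rewrite /rsum; congr (fine (_ - _)); apply: eq_esum => u /= us; rewrite /funrpos/funrneg E.
by rewrite rsumZ ?invr_gt0// mulrA divff ?mul1r// gt_eqF.
Qed.

Definition drift_gap (r : R) (w : Omega) : R := (X r w - eta r w) / (T - r).

(* By the Levy-Ito form and [rsum_jump_eta], the numerator of the drift of
   [Mtilde] at [r] is almost surely [X r - eta r]. *)
Definition Mlevy (t : R) (w : Omega) : R :=
  eta t w - \int[lebesgue_measure]_(r in `[0, t]) drift_gap r w
  - t ^+ 2 / (2 * T) * mean_rate lambda nu.

(** The exceptional null set is that of the Levy-Ito form and does not depend on the time, so the
    integrands agree at every point of [0, t] at once. *)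
Lemma Mtilde_ae : {ae P, forall w, forall t, 0 <= t <= T ->
  Mtilde T lambda nu eta t w = Mlevy t w}.
Proof.
apply: filterS (fvl_levy_ito fvX) => w LI t /andP[t0 tT].
rewrite /Mtilde /Mlevy; congr (_ - _ - _); apply: eq_Rintegral => s.
rewrite inE/= in_itv/= => /andP[s0 st].
have sT : 0 <= s <= T by rewrite s0 (le_trans st).
by rewrite rsum_jump_eta// -LI.
Qed.

End eta_paths.

Section drift_gap_moments.
Context d (Omega : measurableType d) (R : realType) (P : probability Omega R).
Variables (T lambda : R) (W X : R -> {RV P >-> R})
  (nu : {measure set (measurableTypeR R) -> \bar R}).
Hypotheses (T0 : 0 < T) (bmW : brownian_motion T W) (fvX : fv_levy_process T X lambda nu)
  (big : nu.-integrable [set x | 1 <= `|x|] (fun x => x%:E)).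

Local Notation eta := (eta_bridge T W X).
Local Notation gap := (drift_gap T W X).
Local Notation mu := (@lebesgue_measure R).

Let TT : 0 <= T <= T. Proof. by rewrite lexx ltW. Qed.

Lemma eta_integrable t : 0 <= t <= T -> P.-integrable setT (EFin \o eta t).
Proof.
move=> tT; apply: (eq_integrable measurableT
  ((EFin \o bridge T W t) \+ (fun w => (t / T)%:E * (X t w)%:E))%E) => //.
apply: integrableD => //; first exact: bridge_integrable.
by apply: integrableZl => //; exact: (levy_integrable fvX big).
Qed.

(** Isolates the only singular term at T, (W_T - W_r)/(T - r), whose mean absolute value is at most
    of order 1/sqrt(T - r), hence integrable in r. *)
Lemma drift_gap_decomp r w : r < T ->
  gap r w = X r w / T + (W T w - W r w) / (T - r) - W T w / T.
Proof.
move=> rT; rewrite /drift_gap /eta_bridge; field.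
by rewrite subr_eq0 !gt_eqF.
Qed.

Lemma measurable_eta u : measurable_fun setT (eta u).
Proof.
by apply: measurable_funD; [apply: measurable_funB => //|]; apply: measurable_funM.
Qed.

Lemma measurable_drift_gap r : measurable_fun setT (gap r).
Proof.
by apply: measurable_funM => //; apply: measurable_funB => //; exact: measurable_eta.
Qed.

Lemma drift_gap_norm_bound : exists K : R, forall r, 0 <= r <= T ->
  (\int[P]_w `|gap r w|%:E <= (K + Num.sqrt 2 * (Num.sqrt (T - r))^-1)%:E)%E.
Proof.
have [C CP] := levy_uniform_bound T0 fvX big.
have C0 : 0 <= C.
  have := CP _ TT; rewrite -lee_fin; apply: le_trans.
  by apply: integral_ge0 => w _; rewrite lee_fin.
(* C/T bounds the term X_r/T and sqrt(2T)/T the term W_T/T; the singular term gives sqrt(2(T -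
   r))/(T - r), which is sqrt(2)/sqrt(T - r). *)
exists (C / T + Num.sqrt (2 * T) / T) => r /andP[r0].
rewrite le_eqVlt => /predU1P[->|rT].
  rewrite (eq_integral (cst 0%E)); last first.
    by move=> w _; rewrite /drift_gap subrr invr0 mulr0 normr0.
  by rewrite integral0 lee_fin !addr_ge0// ?mulr_ge0// ?invr_ge0 ?sqrtr_ge0 ?ltW.
have Tr0 : 0 < T - r by rewrite subr_gt0.
have rT' : 0 <= r <= T by rewrite r0 ltW.
have mXr : measurable_fun setT (fun w => (`|X r w|%:E)) by apply/measurable_EFinP; exact: measurableT_comp.
have mWr : measurable_fun setT (fun w => (`|W T w - W r w|%:E)).
  by apply/measurable_EFinP; apply: measurableT_comp => //; exact: measurable_funB.
have mWT : measurable_fun setT (fun w => (`|W T w - W 0 w|%:E)).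
  by apply/measurable_EFinP; apply: measurableT_comp => //; exact: measurable_funB.
have Tr0' : (0 <= ((T - r)^-1)%:E)%E by rewrite lee_fin invr_ge0 ltW.
have T0' : (0 <= (T^-1)%:E)%E by rewrite lee_fin invr_ge0 ltW.
pose h w : \bar R := ((T^-1)%:E * `|X r w|%:E + ((T - r)^-1)%:E * `|W T w - W r w|%:E
  + (T^-1)%:E * `|W T w - W 0 w|%:E)%E.
have m1 : measurable_fun setT (fun w => ((T^-1)%:E * `|X r w|%:E)%E) by exact: emeasurable_funM.
have m2 : measurable_fun setT (fun w => (((T - r)^-1)%:E * `|W T w - W r w|%:E)%E) by exact: emeasurable_funM.
have m3 : measurable_fun setT (fun w => ((T^-1)%:E * `|W T w - W 0 w|%:E)%E) by exact: emeasurable_funM.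
apply: (@le_trans _ _ (\int[P]_w h w)%E).
  apply: ge0_le_integral => //.
  - apply/measurable_EFinP; apply: measurableT_comp => //; exact: measurable_drift_gap.
  - by apply: emeasurable_funD => //; exact: emeasurable_funD.
  move=> w _; rewrite /h -!EFinM -!EFinD lee_fin drift_gap_decomp// (bm_start bmW) subr0.
  rewrite (le_trans (ler_normB _ _))// lerD//.
    rewrite (le_trans (ler_normD _ _))// lerD// normrM mulrC ler_wpM2r//.
      by rewrite gtr0_norm// invr_gt0.
    by rewrite gtr0_norm// invr_gt0.
  by rewrite normrM mulrC ler_wpM2r// gtr0_norm// invr_gt0.
rewrite ge0_integralD//; last 3 first.
- by move=> w _; apply: adde_ge0; apply: mule_ge0.
- exact: emeasurable_funD.
- by move=> w _; exact: mule_ge0.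
rewrite ge0_integralD//; last 2 first.
- by move=> w _; exact: mule_ge0.
- by move=> w _; exact: mule_ge0.
rewrite !ge0_integralZl//.
apply: (@le_trans _ _ ((T^-1)%:E * C%:E + ((T - r)^-1)%:E * (Num.sqrt (2 * (T - r)))%:E
  + (T^-1)%:E * (Num.sqrt (2 * T))%:E)%E).
  apply: leeD; first apply: leeD; apply: lee_wpmul2l => //.
  - exact: CP.
  - exact: (bm_increment_norm bmW r0 rT (lexx T)).
  - have := bm_increment_norm bmW (lexx 0) T0 (lexx T); by rewrite subr0.
rewrite -!EFinM -!EFinD lee_fin le_eqVlt; apply/orP; left; apply/eqP.
have sE : (T - r)^-1 = (Num.sqrt (T - r))^-1 * (Num.sqrt (T - r))^-1.
  by rewrite -invfM -expr2 sqr_sqrtr// ltW.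
rewrite sE sqrtrM//; field.
by rewrite !gt_eqF ?sqrtr_gt0.
Qed.

End drift_gap_moments.

(** * Exchanging the drift integral and the expectation *)

Section fubini.
Context d (Omega : measurableType d) (R : realType) (P : probability Omega R).
Variables (T lambda : R) (W X : R -> {RV P >-> R})
  (nu : {measure set (measurableTypeR R) -> \bar R}).
Hypotheses (T0 : 0 < T) (bmW : brownian_motion T W) (fvX : fv_levy_process T X lambda nu)
  (big : nu.-integrable [set x | 1 <= `|x|] (fun x => x%:E)).

Local Notation eta := (eta_bridge T W X).
Local Notation gap := (drift_gap T W X).
Local Notation mu := (@lebesgue_measure R).

Let TT : 0 <= T <= T. Proof. by rewrite lexx ltW. Qed.

Lemma measurable_joint_drift_gap :
  measurable_fun setT (fun p : Omega * measurableTypeR R =>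
    (X (clamp T p.2) p.1 - eta (clamp T p.2) p.1) / (T - p.2)).
Proof.
have m2 := @measurable_snd _ _ Omega (measurableTypeR R).
have mX : measurable_fun setT (fun p : Omega * measurableTypeR R => X (clamp T p.2) p.1).
  apply: (measurable_rcont (Y := fun u w => X (clamp T u) w)) => // w.
  exact: (rcll_clamp (levy_cadlag (fvl_levy fvX) w) TT).1.
have me : measurable_fun setT (fun p : Omega * measurableTypeR R => eta (clamp T p.2) p.1).
  apply: (measurable_rcont (Y := fun u w => eta (clamp T u) w)) => [u|w].
    exact: measurable_eta.
  exact: (rcll_clamp (cadlag_eta T0 bmW fvX w) TT).1.
apply: measurable_funM; first exact: measurable_funB.
by apply: (measurableT_comp (@measurable_inv R)); apply: measurable_funB => //; exact: m2.
Qed.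

Section horizon.
Variable t : R.
Hypothesis tT : 0 <= t <= T.

Let F (p : Omega * measurableTypeR R) : R :=
  (X (clamp T p.2) p.1 - eta (clamp T p.2) p.1) / (T - p.2) * \1_(`[0, t]%classic) p.2.

Let mF : measurable_fun setT F.
Proof.
apply: measurable_funM; first exact: measurable_joint_drift_gap.
have m1 : measurable_fun setT (\1_(`[0, t]%classic) : measurableTypeR R -> R) by exact: measurable_indic.
exact: measurableT_comp m1 (@measurable_snd _ _ Omega (measurableTypeR R)).
Qed.

Let FE w r : F (w, r) = if r \in `[0, t] then gap r w else 0.
Proof.
rewrite /F indicE mem_setE /=; case: ifPn; rewrite ?mulr0// mulr1 in_itv/= => /andP[r0 rt].
by rewrite clamp_id// r0 (le_trans rt)//; case/andP: tT.
Qed.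

Let integral_F w : (\int[mu]_r (F (w, r))%:E = \int[mu]_(r in `[0%R, t]) (gap r w)%:E)%E.
Proof.
rewrite [RHS]integral_mkcond; apply: eq_integral => r _.
by rewrite patchE mem_setE FE; case: ifP.
Qed.

Lemma joint_drift_gap_integrable : (P \x mu)%E.-integrable setT (EFin \o F).
Proof.
have mFE : measurable_fun setT (EFin \o F) by exact/measurable_EFinP.
apply/(integrable21ltyP P mu mFE).
have [K KP] := drift_gap_norm_bound T0 bmW fvX big.
have K0 : 0 <= K.
  have := KP _ TT; rewrite subrr sqrtr0 invr0 mulr0 addr0 -lee_fin; apply: le_trans.
  by apply: integral_ge0 => w _; rewrite lee_fin.
pose b (r : R) : \bar R := (K%:E + (Num.sqrt 2)%:E * ((Num.sqrt (T - r))^-1)%:E)%E.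
have b0 r : (0 <= b r)%E by rewrite /b -EFinM -EFinD lee_fin addr_ge0// mulr_ge0 ?sqrtr_ge0// invr_ge0 sqrtr_ge0.
have ms : measurable_fun setT (fun r : R => ((Num.sqrt (T - r))^-1)%:E).
  apply/measurable_EFinP; apply: measurableT_comp (@measurable_inv R) _.
  apply: measurableT_comp (continuous_measurable_fun (@sqrt_continuous R)) _.
  exact: measurable_funB.
have mb : measurable_fun setT b by apply: emeasurable_funD => //; exact: emeasurable_funM.
apply: (@le_lt_trans _ _ (\int[mu]_(r in `[0%R, T]) b r)%E).
  rewrite [leRHS]integral_mkcond; apply: ge0_le_integral => //.
  - by move=> r _; apply: integral_ge0 => w _.
  - apply: (@measurable_fun_fubini_tonelli_G _ _ Omega (measurableTypeR R) R P (fun p => `|(F p)%:E|%E)) => //.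
    exact: measurableT_comp.
  - by apply/(measurable_restrictT _ _).1 => //; exact: measurable_funTS.
  move=> r _; rewrite patchE mem_setE; case: ifPn => rT; last first.
    rewrite (eq_integral (cst 0%E)) ?integral0// => w _.
    rewrite /= FE; case: ifPn; rewrite ?normr0// in_itv/= => /andP[r0 rt].
    by move: rT; rewrite in_itv/= r0 (le_trans rt)//; case/andP: tT.
  rewrite in_itv/= in rT; apply: (@le_trans _ _ (\int[P]_w `|gap r w|%:E)%E); last first.
    by rewrite /b -EFinM -EFinD; exact: KP.
  apply: ge0_le_integral => //.
  - apply/measurable_EFinP; apply: measurableT_comp => //.
    exact: (measurable_fun_pair1 r mF).
  - by apply/measurable_EFinP; apply: measurableT_comp => //; exact: measurable_drift_gap.
  - by move=> w _; rewrite lee_fin FE; case: ifP => //; rewrite normr0.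
have s0 r : (0 <= ((Num.sqrt (T - r))^-1)%:E)%E by rewrite lee_fin invr_ge0 sqrtr_ge0.
have s20 : (0 <= (Num.sqrt 2 : R)%:E)%E by rewrite lee_fin sqrtr_ge0.
have mss : measurable_fun `[0, T] (fun r : R => ((Num.sqrt 2)%:E * ((Num.sqrt (T - r))^-1)%:E)%E).
  by apply: measurable_funTS; exact: emeasurable_funM.
rewrite ge0_integralD//.
rewrite integral_cst//= lebesgue_measure_itv/= lte_fin T0 -EFinB -EFinM.
rewrite ge0_integralZl//; last exact: measurable_funTS.
apply: lte_add_pinfty; first by rewrite ltry.
apply: lte_mul_pinfty => //.
by apply: le_lt_trans (integral_inv_sqrt_reflected T0) _; rewrite ltry.
Qed.

Let J w : R := \int[mu]_(r in `[0, t]) gap r w.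

Let FF := fubini_F mu (EFin \o F).

Let FF_int : P.-integrable setT FF.
Proof. exact: integrable_fubini_F joint_drift_gap_integrable. Qed.

(** [J] takes [fine] of the inner integral, so it is identified with [FF] where the latter is
    finite, that is almost surely. *)
Let J_ae : ae_eq P setT (EFin \o J) FF.
Proof.
apply: filterS (integrable_ae measurableT FF_int) => w /(_ Logic.I) Ffin _.
rewrite /= /J /Rintegral -integral_F fineK//.
Qed.

Let mJ : measurable_fun setT (EFin \o J).
Proof.
apply/measurable_EFinP.
rewrite (_ : J = fine \o FF); last first.
  by apply/funext => w; rewrite /J /Rintegral -integral_F.
by apply: measurableT_comp => //; case/integrableP: FF_int.
Qed.

Lemma drift_integral_integrable : P.-integrable setT (EFin \o J).
Proof. exact: ae_eq_integrable mJ J_ae FF_int. Qed.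

Section event.
Variable A : set Omega.
Hypothesis mA : measurable A.

(** The event enters as a factor of the integrand, so that Fubini's theorem is applied on the whole
    product space. *)
Let FA (p : Omega * measurableTypeR R) : R := F p * \1_A p.1.

Let FA_int : (P \x mu)%E.-integrable setT (EFin \o FA).
Proof.
have m1 : measurable_fun setT (\1_A : Omega -> R) by exact: measurable_indic.
apply: (le_integrable measurableT _ _ joint_drift_gap_integrable) => [|p _].
  apply/measurable_EFinP; apply: measurable_funM => //.
  exact: measurableT_comp m1 (@measurable_fst _ _ Omega (measurableTypeR R)).
rewrite lee_fin /FA normrM indicE; case: (_ \in A); first by rewrite normr1 mulr1.
by rewrite normr0 mulr0.
Qed.

Let integral_FA r : (\int[P]_w (FA (w, r))%:E =
  if (r : R) \in `[0%R, t] then \int[P]_(w in A) (gap r w)%:E else 0)%E.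
Proof.
case: ifPn => rt; last first.
  rewrite (eq_integral (cst 0%E)) ?integral0// => w _.
  by rewrite /FA FE (negbTE rt) mul0r.
rewrite [RHS]integral_mkcond; apply: eq_integral => w _.
by rewrite patchE /FA FE rt indicE; case: ifP => _; rewrite ?mulr1 ?mulr0.
Qed.

Let restrictE : (fun r : R => \int[P]_(w in A) (gap r w)%:E)%E \_ `[0, t]%classic =
  fubini_G P (EFin \o FA).
Proof. by apply/funext => r; rewrite patchE mem_setE /fubini_G /= integral_FA. Qed.

Lemma drift_integral_slice : mu.-integrable `[0, t] (fun r : R => \int[P]_(w in A) (gap r w)%:E)%E.
Proof.
apply/(integrable_mkcond _ _).2 => //; rewrite restrictE.
have mFA := measurable_int _ FA_int.
apply/integrableP; split; first exact: measurable_fubini_G FA_int.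
apply: le_lt_trans ((integrable21ltyP P mu mFA).1 FA_int).
apply: ge0_le_integral => //.
- by apply: measurableT_comp => //; exact: measurable_fubini_G FA_int.
- apply: (@measurable_fun_fubini_tonelli_G _ _ Omega (measurableTypeR R) R P (abse \o (EFin \o FA))) => //=.
  exact: measurableT_comp.
move=> r _; apply: le_abse_integral => //.
exact: measurable_fun_pair1.
Qed.

Lemma drift_integral_swap : (\int[P]_(w in A) (J w)%:E =
  \int[mu]_(r in `[0%R, t]) \int[P]_(w in A) (gap r w)%:E)%E.
Proof.
transitivity (\int[P]_w \int[mu]_r (FA (w, r))%:E)%E.
  rewrite (ae_eq_integral FF)//; last 3 first.
  - exact: measurable_funTS.
  - by apply: measurable_funTS; case/integrableP: FF_int.
  - by apply: filterS J_ae => w H _; exact: H.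
  rewrite integral_mkcond; apply: eq_integral => w _.
  rewrite patchE; case: ifPn => wA.
    by apply: eq_integral => r _; rewrite /FA indicE wA mulr1.
  by rewrite (eq_integral (cst 0%E)) ?integral0// => r _; rewrite /FA indicE (negbTE wA) mulr0.
rewrite (Fubini FA_int) [RHS]integral_mkcond restrictE.
by apply: eq_integral.
Qed.

End event.
End horizon.
End fubini.

(** * The martingale property *)

Lemma Rintegral_affine (R : realType) (a b c k : R) : a < b ->
  \int[lebesgue_measure]_(r in `[a, b]) (c + k * (r - a)) =
  c * (b - a) + k / 2 * (b - a) ^+ 2.
Proof.
move=> ab; pose F (x : R) := c * (x - a) + k / 2 * (x - a) ^+ 2.
have dF (x : R) : is_derive x 1 F (c + k * (x - a)).
  by apply: is_derive_eq; rewrite /GRing.scale/=; field; rewrite ?pnatr_eq0.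
have cF (y : R) : {for y, continuous F}.
  by apply: differentiable_continuous; apply/derivable1_diffP; case: (dF y).
rewrite /Rintegral (@continuous_FTC2 _ (fun r => c + k * (r - a)) F)//.
- by rewrite /F /= subrr; ring.
- apply: continuous_in_subspaceT => x _; apply: cvgD; first exact: cvg_cst.
  by apply: cvgM; [exact: cvg_cst|apply: cvgB; [exact: cvg_id|exact: cvg_cst]].
- split; first by move=> x _; case: (dF x).
  + by apply: cvg_at_right_filter; exact: cF.
  + by apply: cvg_at_left_filter; exact: cF.
- by move=> x _; rewrite derive1E; case: (dF x).
Qed.

Section main.
Context d (Omega : measurableType d) (R : realType) (P : probability Omega R).
Variables (T lambda : R) (W X : R -> {RV P >-> R})
  (nu : {measure set (measurableTypeR R) -> \bar R}).
Hypotheses (T0 : 0 < T) (bmW : brownian_motion T W) (fvX : fv_levy_process T X lambda nu)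
  (WX : indep_processes T W X)
  (big : nu.-integrable [set x | 1 <= `|x|] (fun x => x%:E)).

Local Notation eta := (eta_bridge T W X).
Local Notation gap := (drift_gap T W X).
Local Notation M := (Mtilde T lambda nu eta).
Local Notation N := (Mlevy T lambda W X nu).
Local Notation mu := (@lebesgue_measure R).

Lemma drift_gap_integrable r : 0 <= r <= T -> P.-integrable setT (EFin \o gap r).
Proof.
move=> rT; have [K KP] := drift_gap_norm_bound T0 bmW fvX big.
apply/integrableP; split; first by apply/measurable_EFinP; exact: measurable_drift_gap.
by apply: le_lt_trans (KP _ rT) _; rewrite ltry.
Qed.

Lemma Mlevy_integrable t : 0 <= t <= T -> P.-integrable setT (EFin \o N t).
Proof.
move=> tT; apply: (eq_integrable measurableT ((EFin \o eta t) \-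
   (fun w => (\int[mu]_(r in `[0%R, t]) gap r w)%:E) \-
   (fun=> (t ^+ 2 / (2 * T) * mean_rate lambda nu)%:E))%E) => //.
apply: integrableB => //; last exact: finite_measure_integrable_cst.
by apply: integrableB => //; [exact: (eta_integrable T0 bmW fvX big)|exact: (drift_integral_integrable T0 bmW fvX big)].
Qed.

Lemma Mtilde_measurable t : 0 <= t <= T -> measurable_fun setT (M t).
Proof.
move=> tT; apply: measurable_Mtilde => // [u _|w]; first exact: measurable_eta.
exact: (cadlag_eta T0 bmW fvX).
Qed.

Lemma Mtilde_Mlevy_ae t : 0 <= t <= T -> ae_eq P setT (EFin \o M t) (EFin \o N t).
Proof.
by move=> tT; apply: filterS (Mtilde_ae T0 bmW fvX) => w H _; rewrite /= H.
Qed.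

Lemma Mtilde_integrable t : 0 <= t <= T -> P.-integrable setT (EFin \o M t).
Proof.
move=> tT; apply: ae_eq_integrable (Mtilde_Mlevy_ae tT) (Mlevy_integrable tT).
by apply/measurable_EFinP; exact: Mtilde_measurable.
Qed.

Lemma Mtilde_adapted t : 0 <= t <= T -> sub_measurable (natural_filtration eta t) (M t).
Proof.
move=> tT _ [B mB <-]; rewrite setTI.
apply: sigma_process_preimage => //.
apply: measurable_Mtilde => // [u ut|w]; last exact: (cadlag_eta T0 bmW fvX).
by apply: (@process_measurable _ _ _ `[0, t]%classic eta); rewrite /= in_itv.
Qed.

Section conditioning.
Variables (s : R) (A : set Omega).
Hypotheses (sT : 0 <= s < T) (pA : <<s past_sets T W X s >> A).

Let s0 : 0 <= s. Proof. by case/andP: sT. Qed.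
Let sT' : s < T. Proof. by case/andP: sT. Qed.
Let ssT : s <= s <= T. Proof. by rewrite lexx ltW. Qed.

Let mA : measurable A.
Proof. by have [] := past_levy fvX WX big sT ssT pA. Qed.

Local Notation m := (mean_rate lambda nu).
Local Notation p := (fine (P A)).
Local Notation x := (\int[P]_(w in A) X s w).
Local Notation b := (\int[P]_(w in A) bridge T W s w).

Let iX r : 0 <= r <= T -> P.-integrable A (EFin \o X r).
Proof.
move=> rT; apply: integrableS (levy_integrable fvX big rT) => //.
Qed.

Let ib r : 0 <= r <= T -> P.-integrable A (EFin \o bridge T W r).
Proof.
move=> rT; apply: integrableS (bridge_integrable T0 bmW rT) => //.
Qed.

Let ig r : 0 <= r <= T -> P.-integrable A (EFin \o gap r).
Proof.
move=> rT; apply: integrableS (drift_gap_integrable rT) => //.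
Qed.

Let iZ (f : Omega -> R) (k : R) : P.-integrable A (EFin \o f) ->
  P.-integrable A (EFin \o (fun w => k * f w)).
Proof. by move=> fA; apply: eq_integrable (integrableZl mA k fA). Qed.

(** The factor T - r in the mean of b_r cancels the denominator of the drift: b_r/(T - r) has the
    same mean over [A] as b_s/(T - s), constant in r and without singularity at T. The slope comes
    from X_r/T alone. *)
Lemma drift_gap_past_mean r : s <= r < T -> \int[P]_(w in A) gap r w =
  (x / T - b / (T - s)) + m * p / T * (r - s).
Proof.
move=> /andP[sr rT]; have rT0 : 0 <= r <= T by rewrite (le_trans s0 sr) ltW.
have srT : s <= r <= T by rewrite sr ltW.
transitivity (\int[P]_(w in A) (T^-1 * X r w - (T - r)^-1 * bridge T W r w)).
  apply: eq_Rintegral => w _; rewrite (drift_gap_decomp W X T0 w rT) /bridge; field.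
  by rewrite subr_eq0 !gt_eqF.
rewrite RintegralB//; [|exact/iZ/iX|exact/iZ/ib].
rewrite !RintegralZl//; [|exact: ib|exact: iX].
rewrite (levy_past_mean fvX WX big sT pA srT) (bridge_past_mean T0 bmW fvX WX big sT pA srT).
by field; rewrite !subr_eq0 !gt_eqF.
Qed.

Let J t w : R := \int[mu]_(r in `[0, t]) gap r w.

Let gamma r : R := \int[P]_(w in A) gap r w.

Let gammaE r : 0 <= r <= T -> (\int[P]_(w in A) (gap r w)%:E = (gamma r)%:E)%E.
Proof.
by move=> rT; rewrite fineK//; exact/integrable_fin_num/ig.
Qed.

Let gamma_int t : 0 <= t <= T -> mu.-integrable `[0, t] (EFin \o gamma).
Proof.
move=> tT; apply: eq_integrable (drift_integral_slice T0 bmW fvX big tT mA) => // r.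
rewrite inE/= in_itv/= => /andP[r0 rt]; rewrite gammaE// r0 (le_trans rt)//.
by case/andP: tT.
Qed.

Let J_mean t : 0 <= t <= T -> \int[P]_(w in A) J t w = \int[mu]_(r in `[0, t]) gamma r.
Proof.
move=> tT; rewrite /Rintegral (drift_integral_swap T0 bmW fvX big tT mA).
congr fine; apply: eq_integral => r; rewrite inE/= in_itv/= => /andP[r0 rt].
by rewrite gammaE// r0 (le_trans rt)//; case/andP: tT.
Qed.

Lemma drift_integral_past_mean t : s < t <= T ->
  \int[P]_(w in A) J t w = \int[P]_(w in A) J s w +
  ((x / T - b / (T - s)) * (t - s) + m * p / T / 2 * (t - s) ^+ 2).
Proof.
move=> /andP[st tT]; have t0T : 0 <= t <= T by rewrite (le_trans s0 (ltW st)).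
have s0T : 0 <= s <= T by rewrite s0 ltW.
apply/eqP; rewrite addrC -subr_eq !J_mean//; apply/eqP.
rewrite Rintegral_itvB ?bnd_simp//; [|exact: gamma_int|exact: ltW].
have gi : mu.-integrable `[s, t] (EFin \o gamma).
  apply: integrableS (gamma_int t0T) => //; apply: subset_itvr; by rewrite bnd_simp.
rewrite Rintegral_itv_obnd_cbnd; last first.
  by apply: integrableS gi => //; apply: subset_itvr; rewrite bnd_simp.
rewrite -Rintegral_itv_bndo_bndc; last first.
  by apply: integrableS gi => //; apply: subset_itvl; rewrite bnd_simp.
(* The affine formula is available for r < T only; the half-open interval keeps it valid when t =
   T. *)
have E r : r \in `[s, t[%classic -> gamma r = x / T - b / (T - s) + m * p / T * (r - s).
  rewrite inE/= in_itv/= => /andP[sr rt]; apply: drift_gap_past_mean.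
  by rewrite sr (lt_le_trans rt).
rewrite (@eq_Rintegral _ (measurableTypeR R) _ mu _ (fun r : R => x / T - b / (T - s) + m * p / T * (r - s))); last first.
  by move=> r /E.
rewrite Rintegral_itv_bndo_bndc ?Rintegral_affine//.
apply: (@eq_integrable _ _ _ mu _ _ (EFin \o gamma)) => //.
  by move=> r /E /= ->.
by apply: integrableS gi => //; apply: subset_itvl; rewrite bnd_simp.
Qed.

Lemma Mlevy_past_mean t : s < t <= T ->
  \int[P]_(w in A) N t w = \int[P]_(w in A) N s w.
Proof.
move=> stT; have /andP[st tT] := stT.
have N_mean u : s <= u <= T -> \int[P]_(w in A) N u w =
    (T - u) / (T - s) * b + u / T * (x + m * (u - s) * p)
    - \int[P]_(w in A) J u w - u ^+ 2 / (2 * T) * m * p.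
  move=> suT; have u0T : 0 <= u <= T by case/andP: suT => su ->; rewrite (le_trans s0).
  have iJ : P.-integrable A (EFin \o J u).
    by apply: integrableS (drift_integral_integrable T0 bmW fvX big u0T).
  have iB : P.-integrable A (EFin \o (fun w => bridge T W u w + u / T * X u w)).
    apply: (eq_integrable mA ((EFin \o bridge T W u) \+ (EFin \o (fun w => (u / T * X u w)%R)))%E) => //.
    by apply: integrableD => //; [exact: ib|exact/iZ/iX].
  rewrite RintegralB//; last 2 first.
  - by apply: (eq_integrable mA ((EFin \o (fun w => (bridge T W u w + u / T * X u w)%R)) \- (EFin \o J u))%E) => //; exact: integrableB.
  - exact: finite_measure_integrable_cst.
  rewrite Rintegral_cst// RintegralB// RintegralD//; [|exact: ib|exact/iZ/iX].
  rewrite RintegralZl//; last exact: iX.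
  by rewrite (levy_past_mean fvX WX big sT pA suT) (bridge_past_mean T0 bmW fvX WX big sT pA suT).
rewrite !N_mean//; last by rewrite (ltW st).
rewrite (drift_integral_past_mean stT).
(* The factors of b add up to (T - t)/(T - s) + (t - s)/(T - s) = 1, those of x to t/T - (t - s)/T =
   s/T, and those of mp/T to t(t - s) - (t - s)^2/2 - t^2/2 = -s^2/2. The last identity explains the
   term t^2/(2T) in the martingale. *)
by field; rewrite subr_eq0 !gt_eqF.
Qed.

Lemma Mtilde_past_mean t : s < t <= T ->
  (\int[P]_(w in A) (M s w)%:E = \int[P]_(w in A) (M t w)%:E)%E.
Proof.
move=> stT; have /andP[st tT] := stT.
have t0T : 0 <= t <= T by rewrite (le_trans s0 (ltW st)).
have s0T : 0 <= s <= T by rewrite s0 ltW.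
have MN u : 0 <= u <= T ->
    (\int[P]_(w in A) (M u w)%:E = (\int[P]_(w in A) N u w)%:E)%E.
  move=> uT; have iN : P.-integrable A (EFin \o N u).
    by apply: integrableS (Mlevy_integrable uT).
  rewrite (ae_eq_integral (EFin \o N u))//.
  - by rewrite fineK//; exact: integrable_fin_num.
  - by apply: measurable_funTS; apply/measurable_EFinP; exact: Mtilde_measurable.
  - exact: measurable_int iN.
  - by apply: filterS (Mtilde_Mlevy_ae uT) => w H _; exact: H.
by rewrite !MN// (Mlevy_past_mean stT).
Qed.

End conditioning.
End main.

Theorem proposition3p2 (d : measure_display) (Omega : measurableType d)
    (R : realType) (P : probability Omega R) (T : R)
    (W X : R -> {RV P >-> R}) (lambda : R)
    (nu : {measure set (measurableTypeR R) -> \bar R}) :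
  0 < T ->
  brownian_motion T W ->
  fv_levy_process T X lambda nu ->
  indep_processes T W X ->
  nu.-integrable [set x | 1 <= `|x|] (fun x => x%:E) ->
  martingale P (natural_filtration (eta_bridge T W X)) T
    (Mtilde T lambda nu (eta_bridge T W X)).
Proof.
move=> T0 bmW fvX WX big; split.
- by move=> t tT; exact: (Mtilde_adapted T0 bmW fvX tT).
- exact: (Mtilde_integrable T0 bmW fvX big).
(* The trivial case s = t is set apart because it includes s = T, while the lemmas on the enlarged
   past require s < T. *)
move=> s t s0; rewrite le_eqVlt => /predU1P[<- sT|st tT].
  have s0T : 0 <= s <= T by rewrite s0.
  split => //; first by exact: (Mtilde_adapted T0 bmW fvX s0T).
  exact: (Mtilde_integrable T0 bmW fvX big).
have sT : 0 <= s < T by rewrite s0 (lt_le_trans st).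
have s0T : 0 <= s <= T by rewrite s0 (le_trans (ltW st)).
split.
- exact: (Mtilde_adapted T0 bmW fvX s0T).
- exact: (Mtilde_integrable T0 bmW fvX big).
move=> A /(natural_filtration_past sT) pA.
by apply: (Mtilde_past_mean T0 bmW fvX WX big sT pA); rewrite st.
Qed.
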